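(* Let $\mathbb{G}$ be a compact quantum group with Haar state $h$ and let $\varphi$ be a state on $C(\mathbb{G})$. If $\varphi$ is non-degenerate on $C(\mathbb{G})$, in the sense that for every nonzero $x\in C(\mathbb{G})_{+}$ there exists $k\geq1$ such that $\varphi^{\star k}(x)>0$, then $$w^{*}\text{-}\lim_{n\to\infty}\frac{1}{n}\sum_{k=1}^{n}\varphi^{\star k}=h.$$ If additionally $h$ is faithful on $C(\mathbb{G})$, then the converse also holds (i.e. this weak* convergence implies that $\varphi$ is non-degenerate).
   Context: A compact quantum group $\mathbb{G}=(C(\mathbb{G}),\Delta)$ is a unital C*-algebra with a unital $*$-homomorphism $\Delta:C(\mathbb{G})\to C(\mathbb{G})\otimes C(\mathbb{G})$ (minimal tensor product) such that $(\Delta\otimes\iota)\Delta=(\iota\otimes\Delta)\Delta$ and $\{\Delta(a)(1\otimes b)\}$, $\{\Delta(a)(b\otimes1)\}$ ($a,b\in C(\mathbb{G})$) are linearly dense in $C(\mathbb{G})\otimes C(\mathbb{G})$. Its Haar state is the unique state $h$ with $(h\otimes\iota)\Delta(x)=h(x)1=(\iota\otimes h)\Delta(x)$ for all $x$. For functionals, $\rho\star\rho'=(\rho\otimes\rho')\circ\Delta$, and $\varphi^{\star k}$ ($k\ge1$) is the $k$-fold convolution power. $C(\mathbb{G})_+$ is the set of positive elements. *)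

(* Defs.v *)
From HB Require Import structures.
From mathcomp Require Import all_boot all_order all_algebra.
From mathcomp Require Import complex.
From mathcomp Require Import all_classical all_reals all_analysis.

Set Implicit Arguments.
Unset Strict Implicit.
Unset Printing Implicit Defensive.

Import Order.TTheory GRing.Theory Num.Theory.
Import numFieldNormedType.Exports.

Local Open Scope classical_set_scope.
Local Open Scope ring_scope.
Local Open Scope complex_scope.

(* R[i] as a normed space over itself; the library declares these instances only
   for variables of the abstract numerical field types. *)
#[non_forgetful_inheritance]
HB.instance Definition _ (R : realType) :=
  PseudoPointedMetric.copy R[i] (R[i]^o).

#[non_forgetful_inheritance]
HB.instance Definition _ (R : realType) :=
  GRing.ComAlgebra.copy R[i] (R[i]^o).

#[non_forgetful_inheritance]
HB.instance Definition _ (R : realType) := NormedModule.copy R[i] (R[i]^o).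

(* Norms take their values in R[i], whose order satisfies
   x <= y <-> Im x = Im y /\ Re x <= Re y; in particular 0 <= z says that z is
   real and nonnegative. *)

(* Nonzero unital C*-algebras (1 <> 0 is forced anyway by the existence of a
   state). The product is part of this structure, and the ring and algebra
   structures are declared afterwards, because a join of the normed and ring
   structures of the libraries would conflict with numDomainType. *)
HB.mixin Record isCstarAlgebra (R : realType) A
    of CompleteNormedModule R[i] A := {
  cstar_one : A;
  cstar_mul : A -> A -> A;
  star : A -> A;
  cstar_mulA : associative cstar_mul;
  cstar_mul1x : left_id cstar_one cstar_mul;
  cstar_mulx1 : right_id cstar_one cstar_mul;
  cstar_mulDl : left_distributive cstar_mul +%R;
  cstar_mulDr : right_distributive cstar_mul +%R;
  cstar_one_neq0 : cstar_one != 0;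
  cstar_scaleAl : forall (c : R[i]) (x y : A),
    c *: cstar_mul x y = cstar_mul (c *: x) y;
  cstar_scaleAr : forall (c : R[i]) (x y : A),
    c *: cstar_mul x y = cstar_mul x (c *: y);
  starK : involutive star;
  star_antilinear : forall (c : R[i]) (x y : A),
    star (c *: x + y) = c^* *: star x + star y;
  star_mul : forall x y : A, star (cstar_mul x y) = cstar_mul (star y) (star x);
  cstar_normM : forall x y : A, `|cstar_mul x y| <= `|x| * `|y|;
  cstar_identity : forall x : A, `|cstar_mul (star x) x| = `|x| ^+ 2
}.

#[short(type="cstarAlgType")]
HB.structure Definition CstarAlgebra (R : realType) :=
  {A of CompleteNormedModule R[i] A & isCstarAlgebra R A}.

#[non_forgetful_inheritance]
HB.instance Definition _ (R : realType) (A : cstarAlgType R) :=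
  GRing.Zmodule_isNzRing.Build A cstar_mulA cstar_mul1x cstar_mulx1
    cstar_mulDl cstar_mulDr cstar_one_neq0.

#[non_forgetful_inheritance]
HB.instance Definition _ (R : realType) (A : cstarAlgType R) :=
  GRing.Lmodule_isLalgebra.Build R[i] A (@cstar_scaleAl R A).

#[non_forgetful_inheritance]
HB.instance Definition _ (R : realType) (A : cstarAlgType R) :=
  GRing.Lalgebra_isAlgebra.Build R[i] A (@cstar_scaleAr R A).

Record hilbertType (R : realType) := HilbertType {
  hilbert_sort :> completeNormedModType R[i];
  inner : {dot hilbert_sort for (@Num.conj R[i])};
  inner_norm : forall u : hilbert_sort, `|u| ^+ 2 = inner u u
}.

Arguments inner {R h}.

Definition linspan (K : numFieldType) (V : lmodType K) (S : set V) : set V :=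
  [set v | exists (n : nat) (c : 'I_n -> K) (s : 'I_n -> V),
    (forall i, S (s i)) /\ v = \sum_(i < n) c i *: s i].

Section Operators.
Context (R : realType).

(* c is the operator norm of the linear map f. *)
Definition is_opnorm (V W : normedModType R[i]) (f : V -> W) (c : R[i]) :=
  [/\ 0 <= c, forall v, `|f v| <= c * `|v| &
      forall d, 0 <= d -> (forall v, `|f v| <= d * `|v|) -> c <= d].

(* pi is a faithful unital *-representation A -> B(H). Faithfulness is
   expressed by ||pi(a)|| = ||a||, that is, A is identified through pi with a
   C*-algebra of operators on H; an injective *-homomorphism between
   C*-algebras is isometric. *)
Definition faithful_representation (A : cstarAlgType R) (H : hilbertType R)
    (pi : A -> H -> H) :=
  [/\ forall a, linear (pi a) /\ is_opnorm (pi a) `|a|,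
      forall (c : R[i]) a b u, pi (c *: a + b) u = c *: pi a u + pi b u,
      forall u, pi 1 u = u,
      forall a b u, pi (a * b) u = pi a (pi b u) &
      forall a u v, inner (pi a u) v = inner u (pi (star a) v)].

(* HK, together with the map (u, v) |-> u (x) v, is the Hilbert space tensor
   product of H and K. *)
Definition hilbert_tensor (H K HK : hilbertType R)
    (ot : {bilinear H -> K -> HK}) :=
  (forall u u' v v', inner (ot u v) (ot u' v') = inner u u' * inner v v') /\
  dense (linspan [set w | exists u v, w = ot u v]).

(* T, together with the map (a, b) |-> a (x) b, is the minimal (spatial) tensor
   product of A and B: for some faithful representations A <= B(H) and
   B <= B(K), it is the closure in B(H (x) K) of the span of the operators
   a (x) b. Since rho is faithful, the formulas for (a (x) b)(a' (x) b'),
   star (a (x) b) and 1 (x) 1 follow. *)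
Definition min_tensor (A B T : cstarAlgType R)
    (tens : {bilinear A -> B -> T}) :=
  dense (linspan [set t | exists a b, t = tens a b]) /\
  exists (H K HK : hilbertType R) (ot : {bilinear H -> K -> HK})
      (pi : A -> H -> H) (sigma : B -> K -> K) (rho : T -> HK -> HK),
    [/\ hilbert_tensor ot,
        faithful_representation pi, faithful_representation sigma,
        faithful_representation rho &
        forall a b u v, rho (tens a b) (ot u v) = ot (pi a u) (sigma b v)].

(* The continuous linear map T -> V which sends a (x) b to beta a b (unique,
   by density; the zero map if there is none). *)
Definition tensor_lift (A B T : cstarAlgType R) (tens : {bilinear A -> B -> T})
    (V : normedModType R[i]) (beta : A -> B -> V) : T -> V :=
  xget (fun=> 0) [set f : T -> V |
    [/\ linear f, continuous f & forall a b, f (tens a b) = beta a b]].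

Definition positive (A : cstarAlgType R) (x : A) :=
  exists y : A, x = star y * y.

Definition state (A : cstarAlgType R) (rho : A -> R[i]) :=
  [/\ scalar rho, forall x, positive x -> 0 <= rho x & rho 1 = 1].

Definition faithful_state (A : cstarAlgType R) (rho : A -> R[i]) :=
  state rho /\ forall x, positive x -> rho x = 0 -> x = 0.

Definition weak_star_cvg (A : cstarAlgType R) (u : nat -> A -> R[i])
    (l : A -> R[i]) :=
  forall x : A, (u n x) @[n --> \oo] --> l x.

End Operators.

(* The minimal tensor products cqg2 = cqg (x) cqg and cqg3 = cqg (x) cqg (x) cqg
   are determined up to isomorphism, so they are recorded as data; cqg3 is at
   once (cqg (x) cqg) (x) cqg and cqg (x) (cqg (x) cqg), identified by tens_assoc.
   The *-homomorphisms comul_id = Delta (x) iota and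
   id_comul = iota (x) Delta are determined by their values on elementary
   tensors. *)
Record compactQuantumGroup (R : realType) := CompactQuantumGroup {
  cqg :> cstarAlgType R;
  cqg2 : cstarAlgType R;
  cqg3 : cstarAlgType R;
  tens : {bilinear cqg -> cqg -> cqg2};
  tens21 : {bilinear cqg2 -> cqg -> cqg3};
  tens12 : {bilinear cqg -> cqg2 -> cqg3};
  tens_min : min_tensor tens;
  tens21_min : min_tensor tens21;
  tens12_min : min_tensor tens12;
  tens_assoc : forall a b c, tens21 (tens a b) c = tens12 a (tens b c);
  comul : {lrmorphism cqg -> cqg2};
  comul_star : forall a, comul (star a) = star (comul a);
  comul_id : {lrmorphism cqg2 -> cqg3};
  comul_id_star : forall t, comul_id (star t) = star (comul_id t);
  comul_id_tens : forall a b, comul_id (tens a b) = tens21 (comul a) b;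
  id_comul : {lrmorphism cqg2 -> cqg3};
  id_comul_star : forall t, id_comul (star t) = star (id_comul t);
  id_comul_tens : forall a b, id_comul (tens a b) = tens12 a (comul b);
  coassoc : forall a, comul_id (comul a) = id_comul (comul a);
  density1 : dense (linspan [set t | exists a b, t = comul a * tens 1 b]);
  density2 : dense (linspan [set t | exists a b, t = comul a * tens b 1])
}.

Section QuantumGroup.
Context (R : realType) (G : compactQuantumGroup R).

Definition tensor_functional (rho rho' : G -> R[i]) : cqg2 G -> R[i] :=
  tensor_lift (@tens R G) (fun a b => rho a * rho' b).

Definition slice_left (rho : G -> R[i]) : cqg2 G -> G :=
  tensor_lift (@tens R G) (fun a b => rho a *: b).

Definition slice_right (rho : G -> R[i]) : cqg2 G -> G :=
  tensor_lift (@tens R G) (fun a b => rho b *: a).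

Definition haar_state (h : G -> R[i]) :=
  state h /\
  forall x : G, slice_left h (comul G x) = h x *: 1 /\
                slice_right h (comul G x) = h x *: 1.

Definition convolution (rho rho' : G -> R[i]) : G -> R[i] :=
  fun x => tensor_functional rho rho' (comul G x).

(* The k-fold convolution power, meaningful for k >= 1 only. *)
Definition convolution_power (rho : G -> R[i]) (k : nat) : G -> R[i] :=
  iter k.-1 (convolution rho) rho.

Definition nondegenerate_state (rho : G -> R[i]) :=
  forall x : G, positive x -> x != 0 ->
    exists2 k : nat, (1 <= k)%N & 0 < convolution_power rho k x.

Definition convolution_average (rho : G -> R[i]) (n : nat) : G -> R[i] :=
  fun x => n%:R^-1 * \sum_(1 <= k < n.+1) convolution_power rho k x.

End QuantumGroup.

(* Main.v *)
Require Import Defs.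
From HB Require Import structures.
From mathcomp Require Import all_boot all_order all_algebra.
From mathcomp Require Import complex.
From mathcomp Require Import all_classical all_reals all_analysis.
From mathcomp Require Import ring lra.

Set Implicit Arguments.
Unset Strict Implicit.
Unset Printing Implicit Defensive.

Import Order.TTheory GRing.Theory Num.Theory.
Import numFieldNormedType.Exports.

Local Open Scope classical_set_scope.
Local Open Scope ring_scope.
Local Open Scope complex_scope.

(* Let psi be the limit of the averages along an ultrafilter; it is a state with
   phi * psi = psi * phi = psi, hence psi * psi = psi. For a in G put
   b = (id (x) psi) Delta(a) and X = Delta(b) - b (x) 1. Since b is fixed by all
   the maps (id (x) phi^k) Delta, one gets (psi (x) phi^k)(X^* X) = 0 for all
   k >= 1, so nondegeneracy forces (psi (x) id)(X^* X) = 0, and the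
   Cauchy-Schwarz inequality gives (psi (x) h)(X) = 0. This says
   h(a) = (psi * psi)(a) = psi(a). As every ultrafilter limit is h, the averages
   converge to h. *)

(** [X] measures how far [b] is from being invariant. Nondegeneracy speaks only of positive elements
    of [G], so it is applied to the slice (psi (x) id)(X^* X), which must be exhibited in the form
    [star y * y]; this shapes the analytic preparation. A minimal tensor product is given only
    through the density of elementary tensors and some faithful representations. A slice is
    therefore bounded on finite sums by matrix coefficients and extended by density. Its positivity
    is reduced to a norm estimate: a self-adjoint element of the closed ball of radius [r] about
    [r *: 1] has a square root, and a unital linear contraction maps such a ball into the
    corresponding one. Slicing the second leg of Delta(a) gives the two invariances of psi different
    tasks: phi * psi = psi makes [b] a fixed point, while psi * phi = psi makes (psi (x) phi^k)(X^*
    X) vanish. *)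

Section Epsilon.
Context (R : realType).
Implicit Types (a b e k : R[i]).

(** The order of [R[i]] is partial, so the failure of [a <= b] yields [b < a] only for real
    numbers. *)
Lemma le_eps a b k : a \is Num.real -> b \is Num.real -> 0 <= k ->
  (forall e, 0 < e -> a <= b + k * e) -> a <= b.
Proof.
move=> aR bR k0 ab; rewrite real_leNgt//; apply/negP => ba.
have k1 : 0 < k + 1 by rewrite ltr_wpDl.
have ba0 : 0 < a - b by rewrite subr_gt0.
(* With this [e], [k * e] stays strictly below [a - b]; [k + 1] replaces [k] to allow [k = 0]. *)
have e0 : 0 < (a - b) / (k + 1) / 2 by rewrite !divr_gt0// ltr0n.
have := ab _ e0; apply/negP; rewrite -lerBlDl.
rewrite -real_ltNge ?realM ?realB ?realV//; last 2 first.
- by rewrite ger0_real.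
- by rewrite gtr0_real// ltr0n.
- rewrite mulrA -(ltr_pM2r (_ : 0 < 2)) ?ltr0n// divfK ?pnatr_eq0//.
  rewrite mulrCA ltr_pM2l//.
  rewrite (@lt_trans _ _ 1)// ?ltr1n// ltr_pdivrMr// mul1r ltrDl ltr01 //.
Qed.

Lemma norm_eps (V : normedModType R[i]) (x : V) k : 0 <= k ->
  (forall e, 0 < e -> `|x| <= k * e) -> x = 0.
Proof.
move=> k0 xk; apply/normr0_eq0/eqP; rewrite eq_le normr_ge0 andbT.
by apply: (@le_eps _ _ k) => // e e0; rewrite add0r xk.
Qed.

Lemma inv_small e : 0 < e -> exists n : nat, 2 / n.+1%:R < e.
Proof.
move=> e0; have /complex_realP[r er] : e \is Num.real by rewrite gtr0_real.
move: e0; rewrite {}er ltcR => r0.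
have rn : 2 / r < (Num.bound (2 / r)).+1%:R.
  rewrite (lt_trans (archi_boundP _)) ?ltr_nat// divr_ge0// ltW//.
exists (Num.bound (2 / r)).
rewrite ltr_pdivrMr ?ltr0n//.
rewrite ltr_pdivrMr// mulrC in rn.
by move: rn; rewrite -ltcR rmorphM /= !rmorph_nat.
Qed.

(** The rate [2 / n.+1%:R] suits both uses: the square root iteration converges at this speed, and
    two approximations of one point within the inverse of [n.+1] differ by at most twice that. *)
Lemma complete_seq (V : completeNormedModType R[i]) (u : nat -> V) :
  (forall n m : nat, (n <= m)%N -> `|u m - u n| <= 2 / n.+1%:R) ->
  exists l, forall n : nat, `|l - u n| <= 2 / n.+1%:R.
Proof.
move=> uc; have /cvg_ex[l ul] : cvg (u @ \oo).
  apply/cauchy_cvgP/cauchy_exP => e e0.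
  have [n ne] := inv_small e0; exists (u n); exists n => // m /= nm.
  by rewrite -ball_normE /= distrC (le_lt_trans (uc _ _ nm)).
exists l => n; apply: (@le_eps _ _ 1) => // e e0.
move/cvgrPdist_lt : ul => /(_ _ e0)[m _ um].
have := um (maxn m n) (leq_maxl _ _) => /ltW lu.
rewrite -(subrKA (u (maxn m n))) (le_trans (ler_normD _ _))// addrC mul1r lerD//.
by rewrite uc// leq_maxr.
Qed.
End Epsilon.

(** * Positive semidefinite sesquilinear forms *)

Section Sesquilinear.
Context (R : realType) (V : lmodType R[i]) (B : V -> V -> R[i]).
Hypothesis Bl : forall c x y z, B (c *: x + y) z = c * B x z + B y z.
Hypothesis Br :
  forall c x y z, B z (c *: x + y) = Num.conj c * B z x + B z y.
Hypothesis B_ge0 : forall x, 0 <= B x x.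

Let B0l z : B 0 z = 0.
Proof.
have := Bl 1 0 0 z; rewrite scale1r addr0 mul1r => /eqP.
by rewrite -subr_eq subrr eq_sym => /eqP.
Qed.

Let B0r z : B z 0 = 0.
Proof.
have := Br 1 0 0 z; rewrite scale1r addr0 rmorph1 mul1r => /eqP.
by rewrite -subr_eq subrr eq_sym => /eqP.
Qed.

Let psd_expand c x y :
  B (c *: x + y) (c *: x + y) =
  c * Num.conj c * B x x + c * B x y + Num.conj c * B y x + B y y.
Proof. by rewrite Bl !Br; ring. Qed.

Lemma ge0_conj (z : R[i]) : 0 <= z -> Num.conj z = z.
Proof. by move=> /ger0_real/CrealP. Qed.

(** Polarization: [B] is real on the diagonal, and comparing its values at [x + y] and [i x + y]
    with their conjugates gives two linear equations, whose combination is the claim multiplied by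
    [2 i]. *)
Lemma psd_hermitian x y : B y x = Num.conj (B x y).
Proof.
have := ge0_conj (B_ge0 (1 *: x + y)).
have := ge0_conj (B_ge0 ((Num.imaginary : R[i]) *: x + y)).
rewrite !psd_expand !rmorphD !rmorphM /= rmorph1 !conjCK conjCi.
rewrite (ge0_conj (B_ge0 x)) (ge0_conj (B_ge0 y)).
move: (Num.conj (B x y)) (Num.conj (B y x)) => p q hi h1.
have i0 : (Num.imaginary : R[i]) != 0 by exact: neq0Ci.
apply/eqP; rewrite -subr_eq0.
rewrite -(mulrI_eq0 _ (mulfI (mulf_neq0 _ i0 : 2 * _ != 0))) ?pnatr_eq0//.
apply/eqP; move/eqP: hi; rewrite -subr_eq0 => /eqP hi.
move/eqP: h1; rewrite -subr_eq0 => /eqP h1.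
rewrite -[RHS](subrr 0) -[X in _ = _ - X](mulr0 Num.imaginary) -{1}hi -h1.
by ring.
Qed.

Lemma psd_CauchySchwarz x y : `|B x y| ^+ 2 <= B x x * B y y.
Proof.
(* The test vector is the component of [u] orthogonal to [v], multiplied by [B v v] to avoid a
   division by a possibly null value. *)
have key u v : 0 <= B v v * (B u u * B v v - `|B u v| ^+ 2).
  have := B_ge0 (- B u v *: v + B v v *: u).
  rewrite psd_expand -[B v v *: u]addr0 !Bl !Br !B0l !B0r !addr0.
  rewrite (psd_hermitian u v) (ge0_conj (B_ge0 v)) normCK rmorphN.
  by congr (_ <= _); ring.
have [vy|vy] := eqVneq (B y y) 0; last first.
  by rewrite -subr_ge0 -(pmulr_rge0 _ (_ : 0 < B y y)) ?key// lt0r vy B_ge0.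
have [vx|vx] := eqVneq (B x x) 0; last first.
  have := key y x; rewrite pmulr_rge0 ?lt0r ?vx ?B_ge0// subr_ge0.
  by rewrite psd_hermitian mulrC norm_conjC.
(* Both diagonal values vanish here, and the form takes at this vector the value minus twice the
   squared modulus of [B x y]. *)
have := B_ge0 (- Num.conj (B x y) *: x + y).
rewrite psd_expand vx vy mulr0 mulr0 add0r addr0 rmorphN /= conjCK.
rewrite (psd_hermitian x y) normCK.
rewrite !mulNr mulrC -opprD oppr_ge0 -mulr2n -mulr_natl pmulr_rle0 ?ltr0n//.
Qed.
End Sesquilinear.

(** * Involution and norm in a C*-algebra *)

Section CstarAlgebra.
Context (R : realType) (A : cstarAlgType R).
Implicit Types (x y z : A) (c r : R[i]).

Lemma starZD c x y : star (c *: x + y) = Num.conj c *: star x + star y.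
Proof. exact: star_antilinear. Qed.

Lemma starM x y : star (x * y) = star y * star x.
Proof. exact: star_mul. Qed.

Lemma starD x y : star (x + y) = star x + star y.
Proof. by rewrite -[x]scale1r starZD rmorph1 !scale1r. Qed.

Lemma star0 : star (0 : A) = 0.
Proof. by apply: (addrI (star 0)); rewrite -starD !addr0. Qed.

Lemma starZ c x : star (c *: x) = Num.conj c *: star x.
Proof. by rewrite -[c *: x]addr0 starZD star0 addr0. Qed.

Lemma starN x : star (- x) = - star x.
Proof. by rewrite -scaleN1r starZ rmorphN1 scaleN1r. Qed.

Lemma starB x y : star (x - y) = star x - star y.
Proof. by rewrite starD starN. Qed.

Lemma star1 : star (1 : A) = 1.
Proof. by rewrite -[star 1]mulr1 -{2}[1 : A]starK -starM mulr1 starK. Qed.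

Lemma norm_star x : `|star x| = `|x|.
Proof.
have le z : `|z| <= `|star z|.
  have [->|z0] := eqVneq z 0; first by rewrite normr0.
  have := cstar_normM (star z) z.
  by rewrite cstar_identity expr2 ler_pM2r// normr_gt0.
by apply/eqP; rewrite eq_le le -{2}[x]starK le.
Qed.

Lemma norm_mul_star x : `|star x * x| = `|x| ^+ 2.
Proof. exact: cstar_identity. Qed.

Lemma normM_le x y : `|x * y| <= `|x| * `|y|.
Proof. exact: cstar_normM. Qed.

End CstarAlgebra.

(** * Square roots of [1 - x] for self-adjoint contractions [x] *)

Section SquareRoot.
Context (R : realType) (A : cstarAlgType R) (x : A).
Hypothesis (x_sa : star x = x) (x1 : `|x| <= 1).

(* [y] converges to 1 - sqrt(1 - x); [s] is the same iteration for the scalar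
   x = 1, and its increments dominate those of [y]. *)
Let y (n : nat) : A := iter n (fun y => 2^-1 *: (x + y * y)) 0.
Let s (n : nat) : R := iter n (fun s => 2^-1 * (1 + s * s)) 0.

(** The defect d = 1 - s n evolves by d |-> d - d^2 / 2, which is increasing on [0, 1], so the bound
    2 / (n + 2) may be inserted. It lands below 2 / (n + 3), with the exact gap 2 / ((n + 3) (n +
    2)^2). *)
Let s_lt1 n : 0 <= s n <= 1 /\ 1 - s n <= 2 / n.+2%:R.
Proof.
elim: n => [|n [/andP[s0 s1] sn]]; first by rewrite /s /= subr0 divff// lexx ler01.
rewrite /s iterS -/(s n); split; first by apply/andP; split; nra.
have n0 : 0 <= n%:R :> R by [].
have : 1 - s n <= 1 by lra.
have -> : 1 - 2^-1 * (1 + s n * s n) = (1 - s n) - (1 - s n) ^+ 2 / 2 by field.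
move: (1 - s n) sn => d dn d1.
apply: (@le_trans _ _ (2 / n.+2%:R - (2 / n.+2%:R) ^+ 2 / 2)).
  have : 2 / n.+2%:R <= 1 :> R by rewrite ler_pdivrMr ?ltr0n// mul1r ler_nat.
  by move: (2 / _) dn => e; nra.
rewrite -subr_ge0 -[n.+3]addn3 -[n.+2]addn2 !natrD.
rewrite [X in 0 <= X](_ : _ = 2 / ((n%:R + 3) * (n%:R + 2) ^+ 2)); last first.
  by field; apply/andP; split; apply: lt0r_neq0; lra.
by rewrite divr_ge0// mulr_ge0 ?sqr_ge0//; lra.
Qed.

Let yS n : y n.+1 = 2^-1 *: (x + y n * y n). Proof. by []. Qed.
Let sS n : s n.+1 = 2^-1 * (1 + s n * s n). Proof. by []. Qed.

Let rcM (a b : R) : (a * b)%:C = a%:C * b%:C. Proof. exact: rmorphM. Qed.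

Let rcD (a b : R) : (a + b)%:C = a%:C + b%:C. Proof. exact: rmorphD. Qed.

Let half_ge0 : 0 <= (2^-1 : R[i]). Proof. by rewrite invr_ge0. Qed.

Let half_C : (2^-1 : R[i]) = (2^-1 : R)%:C.
Proof. by rewrite fmorphV rmorph_nat. Qed.

Let y_le n : `|y n| <= (s n)%:C.
Proof.
elim: n => [|n IH]; first by rewrite normr0.
rewrite yS sS normrZ ger0_norm// rmorphM /= -half_C ler_wpM2l//.
rewrite rmorphD rmorphM /= (le_trans (ler_normD _ _))// lerD//.
by rewrite (le_trans (normM_le _ _))// ler_pM.
Qed.

(** The difference of two squares is split with one factor on the left and one on the right, which
    avoids any commutation; the same identity for [s] dominates it term by term. *)
Let y_step n : `|y n.+1 - y n| <= (s n.+1 - s n)%:C.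
Proof.
elim: n => [|n IH].
  rewrite yS sS /= mul0r mulr0 !addr0 !subr0 mulr1 normrZ ger0_norm// -half_C.
  by rewrite ler_piMr.
have -> : y n.+2 - y n.+1 =
    2^-1 *: (y n.+1 * (y n.+1 - y n) + (y n.+1 - y n) * y n).
  rewrite [in LHS]yS [X in _ - X]yS -scalerBr; congr (_ *: _).
  by rewrite mulrBr mulrBl subrKA opprD addrACA subrr add0r.
have -> : s n.+2 - s n.+1 =
    2^-1 * (s n.+1 * (s n.+1 - s n) + (s n.+1 - s n) * s n).
  by rewrite [in LHS]sS [X in _ - X]sS; field.
rewrite normrZ ger0_norm// rmorphM /= -half_C ler_wpM2l//.
rewrite (le_trans (ler_normD _ _))// rcD (rcM (s n.+1)) (rcM _ (s n)).
by rewrite lerD// (le_trans (normM_le _ _))// ler_pM// (y_le n.+1).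
Qed.

(** Telescoping [y_step] bounds the distance by [s m - s n], hence by [1 - s n]. *)
Let y_cauchy n m : (n <= m)%N -> `|y m - y n| <= 2 / n.+1%:R.
Proof.
move=> nm; have ys : `|y m - y n| <= (s m - s n)%:C.
  elim: m nm => [|m IH].
    by rewrite leqn0 => /eqP ->; rewrite !subrr normr0.
  rewrite leq_eqVlt ltnS => /predU1P[->|/IH]; first by rewrite !subrr normr0.
  move=> nm; rewrite -(subrKA (y m)) -[s m.+1 - _](subrKA (s m)).
  by rewrite (le_trans (ler_normD _ _))// rmorphD lerD.
apply: (le_trans ys).
have [_ sn] := s_lt1 n; have [/andP[_ sm] _] := s_lt1 m.
have -> : (2 / n.+1%:R : R[i]) = (2 / n.+1%:R : R)%:C.
  by rewrite rmorphM fmorphV /= !rmorph_nat.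
rewrite lecR (@le_trans _ _ (1 - s n))// ?lerD2r//.
by rewrite (le_trans sn)// ler_pM2l ?ltr0n// lef_pV2 ?posrE ?ltr0n// ler_nat.
Qed.

Let y_sa n : star (y n) = y n.
Proof.
elim: n => [|n IH]; first by rewrite star0.
by rewrite yS starZ starD starM IH x_sa ge0_conj.
Qed.

(** The limit [l] of the iteration is self-adjoint and solves [x + l * l = 2 *: l], so [1 - l] is a
    self-adjoint square root of [1 - x]. *)
Lemma positive_one_sub : positive (1 - x).
Proof.
have [l yl] := complete_seq y_cauchy.
have l1 : `|l| <= 2 by have := yl 0%N; rewrite subr0 divr1.
have l_sa : star l = l.
  apply/eqP; rewrite -subr_eq0; apply/eqP/(@norm_eps _ _ _ 2) => // e /inv_small[n ne].
  rewrite -(subrKA (star (y n))) -starB y_sa (le_trans (ler_normD _ _))//.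
  rewrite norm_star -normrN opprB [X in _ + X]distrC.
  rewrite mulr_natl mulr2n lerD//.
    by rewrite distrC (le_trans (yl n))// ltW.
  by rewrite (le_trans (yl n))// ltW.
have lE : x + l * l = 2 *: l.
  (* The errors are at most [2 * e] (from [|l| <= 2]), [e] (from [|y n| <= 1]) and [2 * e]; the
     constant 8 is a generous total. *)
  apply/eqP; rewrite -subr_eq0; apply/eqP/(@norm_eps _ _ _ 8) => // e /inv_small[n ne].
  have ln : `|l - y n| <= e := le_trans (yl _) (ltW ne).
  have lSn : `|l - y n.+1| <= e.
    apply: le_trans (yl _) (le_trans _ (ltW ne)).
    by rewrite ler_pM2l ?ltr0n// lef_pV2 ?posrE ?ltr0n// ler_nat.
  have abel (a b c d : A) : b - d - (c - (a + d)) = a + b - c.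
    by rewrite opprB addrA [b - d + _]addrC addrA [a + d + b]addrAC addrK.
  have -> : x + l * l - 2 *: l = (l * (l - y n) + (l - y n) * y n) - 2 *: (l - y n.+1).
    rewrite yS scalerBr scalerA divff ?pnatr_eq0// scale1r.
    by rewrite mulrBr mulrBl subrKA abel.
  have yn1 : `|y n| <= 1.
    rewrite (le_trans (y_le n))// -(rmorph1 (real_complex R)) lecR.
    by have [/andP[]] := s_lt1 n.
  rewrite (le_trans (ler_normB _ _))// normrZ.
  rewrite (_ : 8 * e = (2 * e + e * 1) + 5 * e); last by ring.
  rewrite lerD ?(le_trans (ler_normD _ _))// ?lerD// ?(le_trans (normM_le _ _)) ?ler_pM//.
  by rewrite normr_nat ler_nat.
exists (1 - l); rewrite starB star1 l_sa mulrBr mulr1 mulrBl mul1r.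
have -> : x = 2 *: l - l * l by rewrite -lE addrK.
by rewrite scaler_nat mulr2n !opprD !opprK !addrA.
Qed.
End SquareRoot.

(** The element [1 - r^-1 *: x] is a self-adjoint contraction, so [r^-1 *: x] has a square root,
    which is rescaled. Positivity thereby becomes a norm condition, which unital contractions
    transport. *)
Lemma positive_ball (R : realType) (A : cstarAlgType R) (r : R[i]) (x : A) :
  0 < r -> star x = x -> `|r *: 1 - x| <= r -> positive x.
Proof.
move=> r0 x_sa xr.
have [||y yE] := @positive_one_sub R A (1 - r^-1 *: x).
- by rewrite starB star1 starZ x_sa ge0_conj// invr_ge0 ltW.
- have -> : 1 - r^-1 *: x = r^-1 *: (r *: 1 - x).
    by rewrite scalerBr scalerA mulVf ?lt0r_neq0// scale1r.
  rewrite normrZ gtr0_norm ?invr_gt0// mulrC ler_pdivrMr// mul1r //.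
exists (sqrtC r *: y); rewrite starZ -scalerAl -scalerAr scalerA.
rewrite -yE subKr ge0_conj ?sqrtC_ge0 ?ltW// -expr2 sqrtCK scalerA.
by rewrite divff ?lt0r_neq0// scale1r.
Qed.

(** * Elementary rules for linear maps and functionals *)

Section LinearMaps.
Context (R : realType) (V W : lmodType R[i]) (F : V -> W).
Hypothesis F_linear : linear F.

Lemma linear_map0 : F 0 = 0.
Proof. by have := F_linear (-1) 0 0; rewrite !scaleN1r oppr0 addr0 addNr. Qed.

Lemma linear_mapZ c x : F (c *: x) = c *: F x.
Proof. by rewrite -[c *: x]addr0 F_linear linear_map0 addr0. Qed.

Lemma linear_mapB x y : F (x - y) = F x - F y.
Proof. by rewrite addrC -scaleN1r F_linear scaleN1r addrC. Qed.

End LinearMaps.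

Section ScalarMaps.
Context (R : realType) (A : lmodType R[i]) (rho : A -> R[i]).
Hypothesis rho_lin : scalar rho.

Lemma scalarZD c x y : rho (c *: x + y) = c * rho x + rho y.
Proof. exact: rho_lin. Qed.

Lemma scalarD x y : rho (x + y) = rho x + rho y.
Proof. by rewrite -[x]scale1r scalarZD scale1r mul1r. Qed.

Lemma scalar0 : rho 0 = 0.
Proof. by apply: (addrI (rho 0)); rewrite -scalarD !addr0. Qed.

Lemma scalarZ c x : rho (c *: x) = c * rho x.
Proof. by rewrite -[c *: x]addr0 scalarZD scalar0 addr0. Qed.

Lemma scalarN x : rho (- x) = - rho x.
Proof. by rewrite -scaleN1r scalarZ mulN1r. Qed.

Lemma scalarB x y : rho (x - y) = rho x - rho y.
Proof. by rewrite scalarD scalarN. Qed.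

Lemma scalar_sum (I : Type) (w : seq I) (F : I -> A) :
  rho (\sum_(i <- w) F i) = \sum_(i <- w) rho (F i).
Proof. exact: (big_morph rho scalarD scalar0). Qed.
End ScalarMaps.

(** * States: Cauchy-Schwarz and contractivity *)

Section States.
Context (R : realType) (A : cstarAlgType R) (rho : A -> R[i]).
Hypothesis rho_state : state rho.

Lemma state_scalar : scalar rho. Proof. by case: rho_state. Qed.

Lemma state_ge0 x : 0 <= rho (star x * x).
Proof. by case: rho_state => _ rho_pos _; apply: rho_pos; exists x. Qed.

Lemma state1 : rho 1 = 1. Proof. by case: rho_state. Qed.

Let Bl c x y z : rho (star z * (c *: x + y)) = c * rho (star z * x) + rho (star z * y).
Proof. by rewrite mulrDr -scalerAr (scalarZD state_scalar). Qed.

Let Br c x y z :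
  rho (star (c *: x + y) * z) = Num.conj c * rho (star x * z) + rho (star y * z).
Proof. by rewrite starZD mulrDl -scalerAl (scalarZD state_scalar). Qed.

Lemma state_star x : rho (star x) = Num.conj (rho x).
Proof.
have := psd_hermitian (B := fun x y => rho (star y * x)) Bl Br state_ge0 x 1.
by rewrite mulr1 star1 mul1r.
Qed.

Lemma state_CauchySchwarz x y :
  `|rho (star y * x)| ^+ 2 <= rho (star x * x) * rho (star y * y).
Proof. exact: (psd_CauchySchwarz (B := fun x y => rho (star y * x)) Bl Br state_ge0). Qed.

Lemma state_norm x : `|rho x| <= `|x|.
Proof.
have [->|x0] := eqVneq x 0; first by rewrite (scalar0 state_scalar) normr0.
have nx : 0 < `|x| by rewrite normr_gt0.
have := state_CauchySchwarz x 1; rewrite star1 mul1r mul1r state1 mulr1 => /le_trans rx.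
rewrite -(@ler_pXn2r _ 2) ?nnegrE//; apply: rx.
(* With this scaling [c *: (star x * x)] has norm 1, so [1 - c *: (star x * x)] is some
   [star y * y], and positivity of [rho] on it bounds [rho (star x * x)] by the squared norm of
   [x]. *)
pose c : R[i] := `|x| ^- 2.
have c0 : 0 < c by rewrite invr_gt0 exprn_gt0.
have [||y yE] := @positive_one_sub R A (c *: (star x * x)).
- by rewrite starZ starM starK ge0_conj// ltW.
- by rewrite normrZ norm_mul_star gtr0_norm// mulVf// lt0r_neq0// exprn_gt0.
have := state_ge0 y; rewrite -yE (scalarB state_scalar) state1 (scalarZ state_scalar).
by rewrite subr_ge0 mulrC ler_pdivrMr ?exprn_gt0// mul1r.
Qed.
End States.

(** * Inner products and norms in a Hilbert space *)

Section Hilbert.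
Context (R : realType) (H : hilbertType R).
Implicit Types (u v w : H) (c : R[i]).

Lemma innerZDl c u v w : inner (c *: u + v) w = c * inner u w + inner v w.
Proof. by rewrite linearPl. Qed.

Lemma innerC u v : inner u v = Num.conj (inner v u).
Proof. by rewrite hermC /= expr0 mul1r. Qed.

Lemma innerZDr c u v w : inner w (c *: u + v) = Num.conj c * inner w u + inner w v.
Proof. by rewrite linearPr. Qed.

Lemma inner_ge0 u : 0 <= inner u u.
Proof. by rewrite -inner_norm exprn_ge0. Qed.

Lemma inner_le u v : `|inner u v| <= `|u| * `|v|.
Proof.
rewrite -(@ler_pXn2r _ 2) ?nnegrE ?mulr_ge0// exprMn !inner_norm.
exact: (psd_CauchySchwarz innerZDl innerZDr inner_ge0).
Qed.

Lemma inner_eq0 u : (forall v, inner u v = 0) -> u = 0.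
Proof.
move=> u0; by apply/eqP; rewrite -normr_eq0 -sqrf_eq0 inner_norm u0.
Qed.

Lemma norm_le_inner u (M : R[i]) :
  0 <= M -> (forall v, `|inner u v| <= M * `|v|) -> `|u| <= M.
Proof.
move=> M0 uM; have [->|u0] := eqVneq u 0; first by rewrite normr0.
have := uM u; rewrite -inner_norm ger0_norm ?exprn_ge0// expr2.
by rewrite ler_pM2r// normr_gt0.
Qed.
End Hilbert.

(** * Faithful representations and contractivity of *-homomorphisms *)

Section Representation.
Context (R : realType) (A : cstarAlgType R) (H : hilbertType R) (pi : A -> H -> H).
Hypothesis pi_rep : faithful_representation pi.

Lemma rep_le a u : `|pi a u| <= `|a| * `|u|.
Proof. by case: pi_rep => /(_ a)[_ []]. Qed.

Lemma rep_norm_le a M :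
  0 <= M -> (forall u, `|pi a u| <= M * `|u|) -> `|a| <= M.
Proof. by case: pi_rep => /(_ a)[_ [_ _ aP]] _ _ _ _; apply: aP. Qed.

Lemma rep_form_le a M :
  0 <= M -> (forall u v, `|inner (pi a u) v| <= M * `|u| * `|v|) -> `|a| <= M.
Proof.
by move=> M0 aM; apply: rep_norm_le => // u; apply: norm_le_inner => //; rewrite mulr_ge0.
Qed.

Lemma rep_linear a : linear (pi a). Proof. by case: pi_rep => /(_ a)[]. Qed.

Lemma repZD c a b u : pi (c *: a + b) u = c *: pi a u + pi b u.
Proof. by case: pi_rep. Qed.

Lemma repM a b u : pi (a * b) u = pi a (pi b u).
Proof. by case: pi_rep. Qed.

Lemma rep1 u : pi 1 u = u. Proof. by case: pi_rep. Qed.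

Lemma rep_adjoint a u v : inner (pi a u) v = inner u (pi (star a) v).
Proof. by case: pi_rep. Qed.

Lemma rep0 u : pi 0 u = 0.
Proof.
by apply/eqP; rewrite -normr_le0 (le_trans (rep_le _ _))// normr0 mul0r.
Qed.

Lemma repZ c a u : pi (c *: a) u = c *: pi a u.
Proof. by rewrite -[c *: a]addr0 repZD rep0 addr0. Qed.

Lemma repB a b u : pi (a - b) u = pi a u - pi b u.
Proof. by rewrite addrC -scaleN1r repZD scaleN1r addrC. Qed.

Lemma rep_sum (I : Type) (w : seq I) (F : I -> A) u :
  pi (\sum_(i <- w) F i) u = \sum_(i <- w) pi (F i) u.
Proof.
apply: (big_morph (pi^~ u) _ (rep0 u)) => a b.
by rewrite -[a]scale1r repZD !scale1r.
Qed.

(** The form of the operator [r *: 1 - star x * x] is positive semidefinite because [|x| ^+ 2 <= r],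
    and on the diagonal it is at most [r * |u| ^+ 2]. Cauchy-Schwarz carries this diagonal bound
    over to all matrix coefficients, hence to the norm. *)
Lemma norm_sub_square (x : A) (r : R[i]) :
  `|x| ^+ 2 <= r -> `|r *: 1 - star x * x| <= r.
Proof.
move=> xr; have r0 : 0 <= r by rewrite (le_trans _ xr)// exprn_ge0.
pose B u v := inner (pi (r *: 1 - star x * x) u) v.
have BE u v : B u v = r * inner u v - inner (pi x u) (pi x v).
  rewrite /B repB repZ rep1 repM -scaleN1r addrC innerZDl mulN1r.
  rewrite rep_adjoint starK addrC; congr (_ - _).
  by rewrite -[r *: u]addr0 innerZDl linear0l addr0.
have B0 u : 0 <= B u u.
  rewrite BE -!inner_norm subr_ge0 (@le_trans _ _ ((`|x| * `|u|) ^+ 2))//.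
    by rewrite ler_pXn2r ?nnegrE ?mulr_ge0// rep_le.
  by rewrite exprMn ler_wpM2r// exprn_ge0.
have Bu u : B u u <= r * `|u| ^+ 2.
  by rewrite BE inner_norm lerBlDr lerDl inner_ge0.
have Bl c u v w : B (c *: u + v) w = c * B u w + B v w.
  by rewrite /B rep_linear innerZDl.
have Br c u v w : B w (c *: u + v) = Num.conj c * B w u + B w v.
  by rewrite /B innerZDr.
apply: rep_form_le => // u v.
rewrite -(@ler_pXn2r _ 2) ?nnegrE ?mulr_ge0//.
apply: le_trans (psd_CauchySchwarz (B := B) Bl Br B0 u v) _.
rewrite (_ : (r * _ * _) ^+ 2 = (r * `|u| ^+ 2) * (r * `|v| ^+ 2)); last by ring.
by rewrite ler_pM.
Qed.
End Representation.

(** With [c] the inverse square of the norm of [a], [1 - c *: (star a * a)] equals some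
    [star y * y]. Its image under [f] is [star (f y) * f y], a positive operator, and this says that
    [f a] is bounded by the norm of [a] on every vector. *)
Lemma morph_norm_le (R : realType) (A B : cstarAlgType R) (H : hilbertType R)
    (pi : B -> H -> H) (f : A -> B) :
    faithful_representation pi -> linear f -> f 1 = 1 ->
    (forall a b, f (a * b) = f a * f b) ->
    (forall a, f (star a) = star (f a)) ->
  forall a, `|f a| <= `|a|.
Proof.
move=> pi_rep fl f1 fM fs a.
have f0 := linear_map0 fl; have fZ := linear_mapZ fl; have fB := linear_mapB fl.
have [->|a0] := eqVneq a 0; first by rewrite f0 !normr0.
have na : 0 < `|a| by rewrite normr_gt0.
pose c : R[i] := `|a| ^- 2.
have c0 : 0 < c by rewrite invr_gt0 exprn_gt0.
have [||y yE] := @positive_one_sub R A (c *: (star a * a)).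
- by rewrite starZ starM starK ge0_conj// ltW.
- by rewrite normrZ norm_mul_star gtr0_norm// mulVf// lt0r_neq0// exprn_gt0.
apply: (rep_norm_le pi_rep) => // u.
rewrite -(@ler_pXn2r _ 2) ?nnegrE ?mulr_ge0//.
have := inner_ge0 (pi (f y) u).
rewrite (rep_adjoint pi_rep) -(repM pi_rep) -fs -fM -yE fB f1 fZ fM fs.
rewrite (repB pi_rep) (repZ pi_rep) (rep1 pi_rep) (repM pi_rep).
rewrite innerC -scaleN1r addrC scalerA innerZDl -inner_norm.
rewrite innerC -(rep_adjoint pi_rep) -inner_norm.
rewrite conjC_ge0 ge0_conj ?exprn_ge0// mulN1r addrC mulNr subr_ge0.
by rewrite mulrC ler_pdivrMr ?exprn_gt0// mulrC -exprMn.
Qed.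

(** * Contractive extension from a dense span *)

Section Extension.
Context (R : realType).

Lemma dense_norm (V : normedModType R[i]) (S : set V) (x : V) (e : R[i]) :
  dense S -> 0 < e -> exists2 y, S y & `|x - y| < e.
Proof.
move=> Sd e0; have [||y [xy Sy]] := Sd (ball x e).
- by exists x; exact: ballxx.
- exact: ball_open.
by exists y => //; move: xy; rewrite -ball_normE.
Qed.

(** Lists of coefficient-index pairs make sums and differences of combinations again combinations,
    by concatenation. The list, not the vector it represents, is the argument, so two families can
    be compared on the same list. *)
Definition lincomb (I : Type) (V : lmodType R[i]) (g : I -> V) (w : seq (R[i] * I)) : V :=
  \sum_(p <- w) p.1 *: g p.2.

Lemma lincombZD I (V : lmodType R[i]) (g : I -> V) c w w' :
  lincomb g ([seq (c * p.1, p.2) | p <- w] ++ w') =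
  c *: lincomb g w + lincomb g w'.
Proof.
rewrite /lincomb big_cat big_map scaler_sumr; congr (_ + _).
by apply: eq_bigr => p _; rewrite scalerA.
Qed.

Lemma lincombB I (V : lmodType R[i]) (g : I -> V) w w' :
  lincomb g ([seq (- 1 * p.1, p.2) | p <- w'] ++ w) =
  lincomb g w - lincomb g w'.
Proof. by rewrite lincombZD scaleN1r addrC. Qed.

(** The norm comparison, applied to differences of lists, sends approximations of [x] to a Cauchy
    sequence; in particular the image is independent of the list that represents a vector. *)
Lemma extend_dense (V : normedModType R[i]) (W : completeNormedModType R[i])
    (I : Type) (g : I -> V) (f : I -> W) :
    (forall x e, 0 < e -> exists w, `|x - lincomb g w| < e) ->
    (forall w, `|lincomb f w| <= `|lincomb g w|) ->
  exists F : V -> W,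
    [/\ linear F, forall x, `|F x| <= `|x| & forall i, F (g i) = f i].
Proof.
move=> gd fg.
(* This inequality against every list [w] characterizes the value at [x]; linearity, contractivity
   and the values on the family are all read off from it. *)
have near x : exists y, forall w, `|y - lincomb f w| <= `|x - lincomb g w|.
  have /choice[w xw] (n : nat) : exists w, `|x - lincomb g w| < n.+1%:R^-1.
    by apply: gd; rewrite invr_gt0.
  have wc n m : (n <= m)%N ->
      `|lincomb f (w m) - lincomb f (w n)| <= 2 / n.+1%:R.
    move=> nm; rewrite -lincombB (le_trans (fg _))// lincombB -(subrKA x).
    rewrite (le_trans (ler_normD _ _))// mulr_natl mulr2n lerD ?(ltW (xw _))//.
    rewrite distrC (le_trans (ltW (xw _)))// lef_pV2 ?posrE ?ltr0n// ler_nat//.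
  have [l wl] := complete_seq wc.
  exists l => w'; apply: (@le_eps _ _ _ 2) => // e /inv_small[n ne].
  rewrite -(subrKA (lincomb f (w n))) (le_trans (ler_normD _ _))//.
  rewrite [_ + 2 * e]addrC mulr_natl mulr2n -addrA lerD ?(le_trans (wl _) (ltW ne))//.
  rewrite -lincombB (le_trans (fg _))// lincombB -(subrKA x) (le_trans (ler_normD _ _))//.
  rewrite distrC lerD// (le_trans (ltW (xw _)))// (le_trans _ (ltW ne))//.
  by rewrite ler_peMl ?invr_ge0// ler1n.
have [F FP] := choice near.
have F_small x w e : `|x - lincomb g w| < e -> `|F x - lincomb f w| <= e.
  by move=> /ltW; apply: le_trans.
exists F; split.
- move=> c x y; apply/eqP; rewrite -subr_eq0; apply/eqP.
  apply: (@norm_eps _ _ _ (2 * (`|c| + 1))) => [|e e0]; first by rewrite mulr_ge0// addr_ge0.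
  have [w xw] := gd x e e0; have [w' yw] := gd y e e0.
  have wE : (c *: x + y) - (c *: lincomb g w + lincomb g w') =
      c *: (x - lincomb g w) + (y - lincomb g w').
    by rewrite scalerBr opprD addrACA.
  have wE' : F (c *: x + y) - (c *: F x + F y) =
      (F (c *: x + y) - (c *: lincomb f w + lincomb f w')) -
      (c *: (F x - lincomb f w) + (F y - lincomb f w')).
    by rewrite scalerBr [X in _ = _ - X]addrACA -opprD opprB subrKA.
  have le2 (X : normedModType R[i]) (a b : X) : `|a| <= e -> `|b| <= e ->
      `|c *: a + b| <= (`|c| + 1) * e.
    move=> ae be; rewrite (le_trans (ler_normD _ _))// mulrDl mul1r lerD//.
    by rewrite normrZ ler_wpM2l.
  rewrite wE' (le_trans (ler_normB _ _))// -mulrA mulr_natl mulr2n lerD//.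
    rewrite -lincombZD (le_trans (FP _ _))// lincombZD wE.
    by apply: le2; rewrite ltW.
  by apply: le2; apply: F_small.
(* The empty list gives contractivity, and a singleton list gives the value at [g i]. *)
- by move=> x; have := FP x [::]; rewrite /lincomb !big_nil !subr0.
move=> i; apply/eqP; rewrite -subr_eq0 -normr_le0.
by have := FP (g i) [:: (1, i)]; rewrite /lincomb !big_seq1 !scale1r subrr normr0.
Qed.

Lemma linear_lincomb (V W : lmodType R[i]) (I : Type) (g : I -> V) (F : V -> W) w :
  linear F -> F (lincomb g w) = lincomb (F \o g) w.
Proof.
move=> Fl; have F0 := linear_map0 Fl.
rewrite /lincomb; elim: w => [|p w IH]; first by rewrite !big_nil.
by rewrite !big_cons Fl IH.
Qed.

Lemma bounded_continuous (V W : normedModType R[i]) (F : V -> W) k :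
  0 <= k -> linear F -> (forall x, `|F x| <= k * `|x|) -> continuous F.
Proof.
move=> k0 Fl F1 x; apply/cvgrPdist_lt => e e0.
have k1 : 0 < k + 1 by rewrite ltr_wpDl.
have ek : 0 < e / (k + 1) by rewrite divr_gt0.
near=> y.
rewrite -(linear_mapB Fl) (le_lt_trans (F1 _))// (@le_lt_trans _ _ ((k + 1) * `|x - y|))//.
  by rewrite ler_wpM2r// lerDl.
rewrite mulrC -ltr_pdivlMr//.

Unshelve. all: by end_near. Qed.

Lemma eq_dense (V W : normedModType R[i]) (I : Type) (g : I -> V) (F F' : V -> W) :
    (forall x e, 0 < e -> exists w, `|x - lincomb g w| < e) ->
    linear F -> continuous F -> linear F' -> continuous F' ->
    (forall i, F (g i) = F' (g i)) -> F = F'.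
Proof.
move=> gd Fl Fc F'l F'c FF'; apply/funext => x.
apply/eqP; rewrite -subr_eq0; apply/eqP/(@norm_eps _ _ _ 2) => // e e0.
have /cvgrPdist_lt/(_ _ e0) := Fc x; have /cvgrPdist_lt/(_ _ e0) := F'c x.
move=> /filterS2 /[apply]-/(_ (fun y => `|F x - F y| < e /\ `|F' x - F' y| < e)).
case/(_ _)/nbhs_ballP => // d /= d0 dP.
have [w xw] := gd x d d0; have [|h1 h2] := dP (lincomb g w); first by rewrite -ball_normE.
have Fw : F (lincomb g w) = F' (lincomb g w).
  by rewrite !linear_lincomb//; apply: eq_bigr => p _; rewrite /= FF'.
rewrite -(subrKA (F (lincomb g w))) (le_trans (ler_normD _ _))//.
by rewrite mulr_natl mulr2n lerD ?ltW// Fw distrC.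
Qed.

(** [tensor_lift] selects some continuous linear map with the prescribed values. Density makes it
    unique, so any contraction with these values identifies it. *)
Lemma tensor_liftP (A B T : cstarAlgType R) (tens : {bilinear A -> B -> T})
    (V : normedModType R[i]) (beta : A -> B -> V) (F : T -> V) :
    (forall x e, 0 < e -> exists w,
       `|x - lincomb (fun p : A * B => tens p.1 p.2) w| < e) ->
    linear F -> (forall t, `|F t| <= `|t|) ->
    (forall a b, F (tens a b) = beta a b) ->
  tensor_lift tens beta = F.
Proof.
move=> gd Fl F1 Fb; have Fc : continuous F.
  by apply: (@bounded_continuous _ _ _ 1) => // t; rewrite mul1r.
have [] := @xgetPex _ (fun=> 0) [set f : T -> V |
    [/\ linear f, continuous f & forall a b, f (tens a b) = beta a b]].
  by exists F; split.
move=> Ll Lc Lb; apply: (eq_dense gd) => // p.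
by rewrite Fb -Lb.
Qed.
End Extension.

(** * Dense spans as lists, and orthogonality to them *)

Section DenseSpan.
Context (R : realType).

Lemma dense_lincomb (V : normedModType R[i]) (I : Type) (g : I -> V) (S : set V) :
    dense (linspan S) -> (forall v, S v -> exists i, v = g i) ->
  forall x (e : R[i]), 0 < e -> exists w, `|x - lincomb g w| < e.
Proof.
move=> Sd Sg x e e0; have [y [n [c [s [Ss ->]]]] xy] := dense_norm x Sd e0.
have [j jP] := choice (fun i => Sg _ (Ss i)).
exists [seq (c i, j i) | i <- index_enum 'I_n].
rewrite /lincomb big_map /=.
by under eq_bigr do rewrite -jP.
Qed.

Lemma inner_dense_eq0 (H : hilbertType R) (I : Type) (g : I -> H) (d : H) :
    (forall x (e : R[i]), 0 < e -> exists w, `|x - lincomb g w| < e) ->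
    (forall i, inner d (g i) = 0) -> d = 0.
Proof.
move=> gd d0; apply: inner_eq0 => v.
have dw w : inner d (lincomb g w) = 0.
  rewrite /lincomb; elim: w => [|p w IH]; first by rewrite big_nil linear0r.
  by rewrite big_cons innerZDr d0 mulr0 add0r.
apply: (@norm_eps _ R[i]^o _ `|d|) => // e /(gd v)[w vw].
have := innerZDr 1 (lincomb g w) (v - lincomb g w) d.
rewrite scale1r addrC subrK dw mulr0 add0r => ->.
by rewrite (le_trans (inner_le _ _))// ler_wpM2l// ltW.
Qed.
End DenseSpan.

(** * The spatial tensor product acting on a Hilbert tensor product *)

Section TensorRepresentation.
Context (R : realType) (A B T : cstarAlgType R) (tens : {bilinear A -> B -> T}).
Context (H K HK : hilbertType R) (ot : {bilinear H -> K -> HK}).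
Context (pi : A -> H -> H) (sigma : B -> K -> K) (rho : T -> HK -> HK).
Hypothesis ot_tensor : hilbert_tensor ot.
Hypothesis pi_rep : faithful_representation pi.
Hypothesis sigma_rep : faithful_representation sigma.
Hypothesis rho_rep : faithful_representation rho.
Hypothesis rho_tens :
  forall a b u v, rho (tens a b) (ot u v) = ot (pi a u) (sigma b v).

Local Notation tens2 := (fun p : A * B => tens p.1 p.2).

Let otE u v u' v' : inner (ot u v) (ot u' v') = inner u u' * inner v v'.
Proof. by case: ot_tensor. Qed.

Let ot_norm u v : `|ot u v| = `|u| * `|v|.
Proof.
by apply/eqP; rewrite -(@eqrXn2 _ 2) ?mulr_ge0// inner_norm otE exprMn !inner_norm.
Qed.

Let ot_dense x (e : R[i]) :
  0 < e -> exists w, `|x - lincomb (fun p : H * K => ot p.1 p.2) w| < e.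
Proof.
have := @dense_lincomb R HK _ (fun p : H * K => ot p.1 p.2) _ (proj2 ot_tensor).
by apply=> _ [u [v ->]]; exists (u, v).
Qed.

(** The sum is the matrix coefficient of the represented element between [ot u v] and [ot u' v'].
    This is the point where the spatial norm enters the bound for slices. *)
Lemma tensor_form w u u' v v' :
  `|\sum_(p <- w) p.1 * inner (pi p.2.1 u) u' * inner (sigma p.2.2 v) v'|
    <= `|lincomb tens2 w| * (`|u| * `|u'|) * (`|v| * `|v'|).
Proof.
have <- : inner (rho (lincomb tens2 w) (ot u v)) (ot u' v') =
    \sum_(p <- w) p.1 * inner (pi p.2.1 u) u' * inner (sigma p.2.2 v) v'.
  rewrite /lincomb (rep_sum rho_rep).
  elim: w => [|p w IH]; first by rewrite !big_nil linear0l.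
  by rewrite !big_cons (repZ rho_rep) innerZDl IH rho_tens otE mulrA.
rewrite (le_trans (inner_le _ _))// ot_norm.
apply: (@le_trans _ _ (`|lincomb tens2 w| * `|ot u v| * (`|u'| * `|v'|))).
  by rewrite ler_wpM2r ?mulr_ge0// rep_le.
by rewrite ot_norm le_eqVlt; apply/orP; left; apply/eqP; ring.
Qed.

Let rho_ot_eq x y : (forall u v, rho x (ot u v) = rho y (ot u v)) -> x = y.
Proof.
move=> xy; apply/eqP; rewrite -subr_eq0 -normr_le0.
have lc z : continuous (rho z).
  exact: (bounded_continuous _ (rep_linear rho_rep z) (rep_le rho_rep z)).
have E : rho x = rho y.
  have := eq_dense ot_dense (rep_linear rho_rep x) (lc x) (rep_linear rho_rep y) (lc y).
  by apply=> -[u v]; exact: xy.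
apply: (rep_norm_le rho_rep) => // u.
by rewrite (repB rho_rep) E subrr normr0 mul0r.
Qed.

Lemma tensM_rep a b a' b' : tens a b * tens a' b' = tens (a * a') (b * b').
Proof.
apply: rho_ot_eq => u v.
by rewrite (repM rho_rep) !rho_tens (repM pi_rep) (repM sigma_rep).
Qed.

Lemma tens1_rep : tens 1 1 = 1.
Proof.
by apply: rho_ot_eq => u v; rewrite rho_tens !rep1.
Qed.

Lemma tens_star_rep a b : star (tens a b) = tens (star a) (star b).
Proof.
apply: rho_ot_eq => u v; apply/eqP; rewrite -subr_eq0; apply/eqP.
apply: (inner_dense_eq0 ot_dense) => -[u' v'] /=.
rewrite linearBl /= rho_tens otE (rep_adjoint rho_rep) starK rho_tens otE.
by rewrite (rep_adjoint pi_rep) (rep_adjoint sigma_rep) !starK subrr.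
Qed.
End TensorRepresentation.

(** * Slice maps: existence, contractivity and module properties *)

Section SliceBound.
Context (R : realType) (A B : cstarAlgType R) (H K : hilbertType R).
Context (pi : A -> H -> H) (sigma : B -> K -> K).
Hypothesis pi_rep : faithful_representation pi.
Hypothesis sigma_rep : faithful_representation sigma.

(* The norm of the slice is tested on vectors v, v' of K; the resulting scalar is
   f of an element of A, whose norm is in turn tested on vectors of H. *)
Lemma slice_bound (I : Type) (w : seq (R[i] * I)) (a : I -> A) (b : I -> B)
    (M : R[i]) (f : A -> R[i]) :
    0 <= M -> scalar f -> (forall x, `|f x| <= `|x|) ->
    (forall u u' v v', 
      `|\sum_(p <- w) p.1 * inner (pi (a p.2) u) u' * inner (sigma (b p.2) v) v'|
        <= M * (`|u| * `|u'|) * (`|v| * `|v'|)) ->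
  `|lincomb (fun i => f (a i) *: b i) w| <= M.
Proof.
move=> M0 fl f1 wM; apply: (rep_form_le sigma_rep) => // v v'.
pose z := \sum_(p <- w) (p.1 * inner (sigma (b p.2) v) v') *: a p.2.
have -> : inner (sigma (lincomb (fun i => f (a i) *: b i) w) v) v' = f z.
  rewrite /z (scalar_sum fl) /lincomb (rep_sum sigma_rep).
  elim: (w) => [|p w' IH]; first by rewrite !big_nil linear0l.
  rewrite !big_cons scalerA (repZ sigma_rep) innerZDl IH (scalarZ fl).
  by congr (_ + _); ring.
rewrite (le_trans (f1 _))//.
apply: (rep_form_le pi_rep) => [|u u']; first by rewrite !mulr_ge0.
have -> : inner (pi z u) u' =
    \sum_(p <- w) p.1 * inner (pi (a p.2) u) u' * inner (sigma (b p.2) v) v'.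
  rewrite /z (rep_sum pi_rep).
  elim: (w) => [|p w' IH]; first by rewrite !big_nil linear0l.
  by rewrite !big_cons (repZ pi_rep) innerZDl IH; congr (_ + _); ring.
rewrite (le_trans (wM _ _ _ _))// le_eqVlt; apply/orP; left; apply/eqP; ring.
Qed.
End SliceBound.

Section Slices.
Context (R : realType) (A B T : cstarAlgType R) (tens : {bilinear A -> B -> T}).
Hypothesis tens_min : min_tensor tens.

(** Arbitrary algebras are allowed because coassociativity also calls for slices of the triple
    tensor product. For [tens G] one recovers [slice_left] and, with [rslice], [slice_right]. *)
Definition lslice (f : A -> R[i]) : T -> B := tensor_lift tens (fun a b => f a *: b).

Definition rslice (f : B -> R[i]) : T -> A := tensor_lift tens (fun a b => f b *: a).

Local Notation tens2 := (fun p : A * B => tens p.1 p.2).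

Lemma tens_dense x (e : R[i]) : 0 < e -> exists w, `|x - lincomb tens2 w| < e.
Proof.
have := @dense_lincomb R T _ tens2 _ (proj1 tens_min).
by apply=> _ [a [b ->]]; exists (a, b).
Qed.

Lemma min_tensor_rep :
  exists (H K HK : hilbertType R) (pi : A -> H -> H) (sigma : B -> K -> K)
      (rho : T -> HK -> HK),
  [/\ faithful_representation pi, faithful_representation sigma &
      faithful_representation rho].
Proof.
case: tens_min => _ [H [K [HK [_ [pi [sigma [rho [_ h1 h2 h3 _]]]]]]]].
by exists H, K, HK, pi, sigma, rho.
Qed.

Lemma tensM a b a' b' : tens a b * tens a' b' = tens (a * a') (b * b').
Proof.
case: tens_min => _ [H [K [HK [ot [pi [sigma [rho [h0 h1 h2 h3 h4]]]]]]]].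
exact: (tensM_rep h0 h1 h2 h3 h4).
Qed.

Lemma tens1 : tens 1 1 = 1.
Proof.
case: tens_min => _ [H [K [HK [ot [pi [sigma [rho [h0 h1 h2 h3 h4]]]]]]]].
exact: (tens1_rep h0 h1 h2 h3 h4).
Qed.

Lemma tens_star a b : star (tens a b) = tens (star a) (star b).
Proof.
case: tens_min => _ [H [K [HK [ot [pi [sigma [rho [h0 h1 h2 h3 h4]]]]]]]].
exact: (tens_star_rep h0 h1 h2 h3 h4).
Qed.

(** The tensor factors as [tens a 1 * tens 1 b], and each leg embedding is a unital *-homomorphism,
    hence contractive. *)
Lemma tens_norm a b : `|tens a b| <= `|a| * `|b|.
Proof.
have [_ [_ [HK [_ [_ [rho [_ _ rho_rep]]]]]]] := min_tensor_rep.
have -> : tens a b = tens a 1 * tens 1 b by rewrite tensM mulr1 mul1r.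
rewrite (le_trans (normM_le _ _))// ler_pM//.
  apply: (morph_norm_le rho_rep (f := fun a => tens a 1)).
  - by move=> c x y; rewrite linearPl.
  - exact: tens1.
  - by move=> x y; rewrite tensM mulr1.
  - by move=> x; rewrite tens_star star1.
apply: (morph_norm_le rho_rep (f := fun b => tens 1 b)).
- by move=> c x y; rewrite linearPr.
- exact: tens1.
- by move=> x y; rewrite tensM mulr1.
- by move=> x; rewrite tens_star star1.
Qed.

Lemma tens_ext (V : normedModType R[i]) (F F' : T -> V) k k' :
    linear F -> 0 <= k -> (forall t, `|F t| <= k * `|t|) ->
    linear F' -> 0 <= k' -> (forall t, `|F' t| <= k' * `|t|) ->
    (forall a b, F (tens a b) = F' (tens a b)) ->
  forall t, F t = F' t.
Proof.
move=> Fl k0 Fk F'l k'0 F'k FF' t; congr (_ t).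
have := eq_dense tens_dense Fl (bounded_continuous k0 Fl Fk) F'l
  (bounded_continuous k'0 F'l F'k).
by apply=> -[a b]; exact: FF'.
Qed.

Section LeftSlice.
Variable f : A -> R[i].
Hypotheses (f_scalar : scalar f) (f_norm : forall x, `|f x| <= `|x|).

Let lsliceP : [/\ linear (lslice f), forall t, `|lslice f t| <= `|t| &
  forall a b, lslice f (tens a b) = f a *: b].
Proof.
have [w|F [Fl F1 Ft]] := @extend_dense R T B _ tens2 (fun p => f p.1 *: p.2) tens_dense.
  case: tens_min => _ [H [K [HK [ot [pi [sigma [rho [h0 h1 h2 h3 h4]]]]]]]].
  apply: (slice_bound h1 h2) => // u u' v v'.
  exact: (tensor_form h0 h3 h4).
have -> : lslice f = F.
  by apply: (tensor_liftP tens_dense) => // a b; exact: (Ft (a, b)).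
by split=> // a b; exact: (Ft (a, b)).
Qed.

Lemma lslice_linear : linear (lslice f). Proof. by case: lsliceP. Qed.

Lemma lslice_norm t : `|lslice f t| <= `|t|. Proof. by case: lsliceP. Qed.

Lemma lslice_tens a b : lslice f (tens a b) = f a *: b. Proof. by case: lsliceP. Qed.

End LeftSlice.

Section RightSlice.
Variable f : B -> R[i].
Hypotheses (f_scalar : scalar f) (f_norm : forall x, `|f x| <= `|x|).

Let rsliceP : [/\ linear (rslice f), forall t, `|rslice f t| <= `|t| &
  forall a b, rslice f (tens a b) = f b *: a].
Proof.
have [w|F [Fl F1 Ft]] := @extend_dense R T A _ tens2 (fun p => f p.2 *: p.1) tens_dense.
  case: tens_min => _ [H [K [HK [ot [pi [sigma [rho [h0 h1 h2 h3 h4]]]]]]]].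
  apply: (slice_bound h2 h1) => // u u' v v'.
  (* The factors are exchanged because here the functional acts on the second leg. *)
  rewrite -mulrA [X in _ <= _ * X]mulrC mulrA.
  under eq_bigr do rewrite mulrAC.
  exact: (tensor_form h0 h3 h4).
have -> : rslice f = F.
  by apply: (tensor_liftP tens_dense) => // a b; exact: (Ft (a, b)).
by split=> // a b; exact: (Ft (a, b)).
Qed.

Lemma rslice_linear : linear (rslice f). Proof. by case: rsliceP. Qed.

Lemma rslice_norm t : `|rslice f t| <= `|t|. Proof. by case: rsliceP. Qed.

Lemma rslice_tens a b : rslice f (tens a b) = f b *: a. Proof. by case: rsliceP. Qed.

(** Together with [rsliceMr], this module property over the first leg pulls [b (x) 1] out of the
    cross terms of [X^* X]. *)
Lemma rsliceMl b t : rslice f (tens b 1 * t) = b * rslice f t.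
Proof.
move: t; apply: (@tens_ext _ _ _ `|tens b 1| `|b|) => //.
- by move=> c x y; rewrite mulrDr -scalerAr rslice_linear.
- by move=> t; rewrite (le_trans (rslice_norm _)) ?normM_le.
- by move=> c x y; rewrite rslice_linear mulrDr -scalerAr.
- by move=> t; rewrite (le_trans (normM_le _ _))// ler_wpM2l// rslice_norm.
by move=> a a'; rewrite tensM mul1r !rslice_tens scalerAr.
Qed.

Lemma rsliceMr b t : rslice f (t * tens b 1) = rslice f t * b.
Proof.
move: t; apply: (@tens_ext _ _ _ `|tens b 1| `|b|) => //.
- by move=> c x y; rewrite mulrDl -scalerAl rslice_linear.
- by move=> t; rewrite [X in _ <= X]mulrC (le_trans (rslice_norm _)) ?normM_le.
- by move=> c x y; rewrite rslice_linear mulrDl -scalerAl.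
- by move=> t; rewrite [X in _ <= X]mulrC (le_trans (normM_le _ _))// ler_wpM2r// rslice_norm.
by move=> a a'; rewrite tensM mulr1 !rslice_tens scalerAl.
Qed.
End RightSlice.
End Slices.

(** * Slices by states: Fubini, adjoints and positivity *)

Section StateSlices.
Context (R : realType) (A B T : cstarAlgType R) (tens : {bilinear A -> B -> T}).
Hypothesis tens_min : min_tensor tens.
Variables (f : A -> R[i]) (g : B -> R[i]).
Hypotheses (f_state : state f) (g_state : state g).

Let fl := state_scalar f_state.
Let gl := state_scalar g_state.
Let f1 := state_norm f_state.
Let g1 := state_norm g_state.

Let ll := lslice_linear tens_min fl f1.
Let rl := rslice_linear tens_min gl g1.
Let l1 := lslice_norm tens_min fl f1.
Let r1 := rslice_norm tens_min gl g1.
Let lE := lslice_tens tens_min fl f1.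
Let rE := rslice_tens tens_min gl g1.

Let comp_scalar (V W : lmodType R[i]) (F : V -> W) (k : W -> R[i]) :
  linear F -> scalar k -> scalar (k \o F).
Proof. by move=> Fl kl c x y; rewrite /= Fl kl. Qed.

Lemma tensor_functionalE :
  tensor_lift tens (fun a b => f a * g b) = g \o lslice tens f.
Proof.
apply: (tensor_liftP (tens_dense tens_min)).
- exact: (comp_scalar ll gl).
- by move=> t; rewrite (le_trans (g1 _)).
- by move=> a b; rewrite /= lE (scalarZ gl).
Qed.

Lemma slice_Fubini t : g (lslice tens f t) = f (rslice tens g t).
Proof.
move: t; apply: (@tens_ext _ _ _ _ _ tens_min R[i] _ _ 1 1) => //.
- exact: (comp_scalar ll gl).
- by move=> t; rewrite mul1r (le_trans (g1 _)).
- exact: (comp_scalar rl fl).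
- by move=> t; rewrite mul1r (le_trans (f1 _)).
by move=> a b; rewrite lE rE !scalarZ// mulrC.
Qed.

Lemma lslice_star t : lslice tens f (star t) = star (lslice tens f t).
Proof.
rewrite -[LHS]starK; congr star; move: t.
apply: (@tens_ext _ _ _ _ _ tens_min B _ _ 1 1) => //.
- by move=> c x y; rewrite starZD ll starZD conjCK.
- by move=> t; rewrite mul1r norm_star (le_trans (l1 _))// norm_star.
- by move=> t; rewrite mul1r.
move=> a b; rewrite (tens_star tens_min) !lE starZ starK.
by rewrite (state_star f_state) conjCK.
Qed.

Lemma rslice_star t : rslice tens g (star t) = star (rslice tens g t).
Proof.
rewrite -[LHS]starK; congr star; move: t.
apply: (@tens_ext _ _ _ _ _ tens_min A _ _ 1 1) => //.
- by move=> c x y; rewrite starZD rl starZD conjCK.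
- by move=> t; rewrite mul1r norm_star (le_trans (r1 _))// norm_star.
- by move=> t; rewrite mul1r.
move=> a b; rewrite (tens_star tens_min) !rE starZ starK.
by rewrite (state_star g_state) conjCK.
Qed.

Lemma lslice1 : lslice tens f 1 = 1.
Proof. by rewrite -(tens1 tens_min) lE (state1 f_state) scale1r. Qed.

(** [star x * x] lies in the ball of radius [r] about [r *: 1]. The slice is linear, unital and
    contractive and commutes with [star], so its value lies in the corresponding ball and
    [positive_ball] applies. *)
Lemma lslice_positive x : positive (lslice tens f (star x * x)).
Proof.
(* The summand 1 keeps the radius positive when [x] is zero. *)
pose r : R[i] := `|x| ^+ 2 + 1.
have r0 : 0 < r by rewrite ltr_wpDl// exprn_ge0.
apply: (positive_ball r0); first by rewrite -lslice_star starM starK.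
rewrite -[in r *: 1]lslice1 -(linear_mapZ ll) -(linear_mapB ll).
have [_ [_ [HK [_ [_ [rho [_ _ rho_rep]]]]]]] := min_tensor_rep tens_min.
by rewrite (le_trans (l1 _))// (norm_sub_square rho_rep)// lerDl.
Qed.

Lemma state_tensor : state (g \o lslice tens f).
Proof.
split.
- exact: (comp_scalar ll gl).
- move=> _ [y ->]; case: g_state => _ g_pos _; apply: g_pos; exact: lslice_positive.
- by rewrite /= lslice1 (state1 g_state).
Qed.

End StateSlices.

(** * Convolution of states and its associativity *)

Section Convolution.
Context (R : realType) (G : compactQuantumGroup R).
Implicit Types (f g k : G -> R[i]) (x : G).

Let t_min := @tens_min R G.
Let t21_min := @tens21_min R G.
Let t12_min := @tens12_min R G.

Lemma lrmorph_norm (A B T C : cstarAlgType R) (tens : {bilinear B -> C -> T})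
    (F : {lrmorphism A -> T}) :
    min_tensor tens -> (forall a, F (star a) = star (F a)) ->
  forall a, `|F a| <= `|a|.
Proof.
move=> tm Fs; have [_ [_ [HK [_ [_ [rho [_ _ rho_rep]]]]]]] := min_tensor_rep tm.
apply: (morph_norm_le rho_rep) => //; [exact: linearP|exact: rmorph1|exact: rmorphM].
Qed.

Lemma comul_norm x : `|comul G x| <= `|x|.
Proof. exact: (lrmorph_norm t_min (@comul_star R G)). Qed.

Lemma convolution_left f g : state f -> state g ->
  convolution f g = fun x => g (slice_left f (comul G x)).
Proof.
by move=> fs gs; rewrite /convolution /tensor_functional (tensor_functionalE t_min).
Qed.

Lemma convolution_right f g : state f -> state g ->
  convolution f g = fun x => f (slice_right g (comul G x)).
Proof.
move=> fs gs; rewrite convolution_left//; apply/funext => x.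
exact: slice_Fubini.
Qed.

Lemma convolution_state f g : state f -> state g -> state (convolution f g).
Proof.
move=> fs gs; rewrite convolution_left//.
have [Fl Fpos F1] := state_tensor t_min fs gs; split.
- move=> c x y.
  by rewrite -[LHS]/((g \o lslice (tens G) f) (comul G (c *: x + y))) linearP Fl.
- move=> _ [y ->]; apply: Fpos; exists (comul G y).
  by rewrite -comul_star -rmorphM.
- by rewrite rmorph1.
Qed.

(** [E1] moves the comultiplication inside the slice as Delta (x) id, [E2] merges the two slices
    into one by g (x) k on the last two legs, and after coassociativity [E3] absorbs id (x) Delta
    into that functional, leaving the convolution. *)
Lemma slice_right_comp g k : state g -> state k -> forall x,
  slice_right g (comul G (slice_right k (comul G x))) =
  slice_right (convolution g k) (comul G x).
Proof.
move=> gs ks x; have gks := convolution_state gs ks.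
have gl := state_scalar gs; have kl := state_scalar ks.
have g1 := state_norm gs; have k1 := state_norm ks.
have gkl := state_scalar gks; have gk1 := state_norm gks.
pose gk := k \o lslice (tens G) g.
have gk_s : state gk := state_tensor t_min gs ks.
have E1 t : comul G (rslice (tens G) k t) = rslice (tens21 G) k (comul_id G t).
  move: t; apply: (@tens_ext _ _ _ _ _ t_min _ _ _ 1 1) => //.
  - by move=> c y z; rewrite rslice_linear// linearP.
  - by move=> t; rewrite mul1r (le_trans (comul_norm _))// rslice_norm.
  - by move=> c y z; rewrite linearP rslice_linear.
  - move=> t; rewrite mul1r (le_trans (rslice_norm t21_min _ _ _))//.
    exact: (lrmorph_norm t21_min (@comul_id_star R G)).
  by move=> a b; rewrite comul_id_tens !rslice_tens// linearZ.
have E2 z : rslice (tens G) g (rslice (tens21 G) k z) = rslice (tens12 G) gk z.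
  have gkl' := state_scalar gk_s; have gk1' := state_norm gk_s.
  move: z; apply: (@tens_ext _ _ _ _ _ t12_min _ _ _ 1 1) => //.
  - by move=> c y z; rewrite !rslice_linear.
  - move=> z; rewrite mul1r (le_trans (rslice_norm t_min _ _ _))//.
    exact: rslice_norm.
  - exact: rslice_linear.
  - by move=> z; rewrite mul1r rslice_norm.
  move=> a t; rewrite rslice_tens//.
  (* A second density argument: the second leg is an arbitrary element of [cqg2 G], and [tens_assoc]
     applies only once it is elementary. *)
  move: t; apply: (@tens_ext _ _ _ _ _ t_min _ _ _ `|a| `|a|) => //.
  - by move=> c y z; rewrite linearPr !rslice_linear.
  - move=> t; rewrite (le_trans (rslice_norm t_min _ _ _))//.
    by rewrite (le_trans (rslice_norm t21_min _ _ _))// tens_norm.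
  - by move=> c y z; rewrite gkl' scalerDl scalerA.
  - by move=> t; rewrite normrZ mulrC ler_wpM2l.
  move=> b c; rewrite -tens_assoc rslice_tens// (linear_mapZ (rslice_linear _ _ _))//.
  by rewrite rslice_tens// /gk /= lslice_tens// (scalarZ kl) scalerA mulrC.
have E3 t : rslice (tens12 G) gk (id_comul G t) = rslice (tens G) (convolution g k) t.
  have gkl' := state_scalar gk_s; have gk1' := state_norm gk_s.
  move: t; apply: (@tens_ext _ _ _ _ _ t_min _ _ _ 1 1) => //.
  - by move=> c y z; rewrite linearP rslice_linear.
  - move=> t; rewrite mul1r (le_trans (rslice_norm t12_min _ _ _))//.
    exact: (lrmorph_norm t12_min (@id_comul_star R G)).
  - exact: rslice_linear.
  - by move=> t; rewrite mul1r rslice_norm.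
  by move=> a b; rewrite id_comul_tens !rslice_tens// convolution_left.
by rewrite /slice_right -/(rslice (tens G) g _) -/(rslice (tens G) k _) E1 E2 coassoc E3.
Qed.

Lemma convolutionA f g k : state f -> state g -> state k ->
  convolution (convolution f g) k = convolution f (convolution g k).
Proof.
move=> fs gs ks; have fgs := convolution_state fs gs; have gks := convolution_state gs ks.
rewrite convolution_right//; apply/funext => x.
by rewrite !convolution_right// -convolution_right// slice_right_comp.
Qed.

End Convolution.

(** * Limits of bounded sequences along an ultrafilter *)

Section UltrafilterLimit.
Context (R : realType).

Lemma ultra_fmap (S T : Type) (U : set_system S) (f : S -> T) :
  UltraFilter U -> UltraFilter (f @ U).
Proof.
move=> UU; split=> [|F FF UF]; first exact: fmap_proper_filter.
apply/seteqP; split=> A FA; last exact: UF.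
have [//|UA] := in_ultra_setVsetC (f @^-1` A) UU.
have /filter_ex[] : F (A `&` ~` A) by apply: filterI => //; exact: UF.
by move=> x [].
Qed.

Lemma ultra_bounded_real (U : set_system nat) (u : nat -> R) (M : R) :
  UltraFilter U -> (forall n, `|u n| <= M) -> exists l : R, u n @[n --> U] --> l.
Proof.
move=> UU uM; have := @segment_compact R (- M) M; rewrite compact_ultra => cM.
have [||l [_ ul]] := cM (u @ U); last by exists l.
  exact: ultra_fmap.
by apply: nearW => n; rewrite /= in_itv /= -ler_norml.
Qed.

(** One fixed ultrafilter provides limits for all bounded sequences at once; choosing the limit for
    each [x] yields the functional [psi]. *)
Lemma ultra_bounded_complex (U : set_system nat) (z : nat -> R[i]) (M : R[i]) :
  UltraFilter U -> (forall n, `|z n| <= M) -> exists l : R[i], z n @[n --> U] --> l.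
Proof.
move=> UU zM.
have le2 n : `|complex.Re (z n)| <= complex.Re M /\ `|complex.Im (z n)| <= complex.Re M.
  have := zM n; rewrite normc_def lecE /= => /andP[_ h].
  split; rewrite (le_trans _ h)// -sqrtr_sqr ler_wsqrtr// ?lerDl ?lerDr sqr_ge0//.
have [a za] := ultra_bounded_real UU (fun n => proj1 (le2 n)).
have [b zb] := ultra_bounded_real UU (fun n => proj2 (le2 n)).
exists (a +i* b); apply/cvgrPdist_lt => e e0.
have /complex_realP[r er] : e \is Num.real by rewrite gtr0_real.
move: e0; rewrite {}er ltcR => r0; have r2 : 0 < r / 2 by rewrite divr_gt0.
move/cvgrPdist_lt : za => /(_ _ r2) za; move/cvgrPdist_lt : zb => /(_ _ r2) zb.
near=> n.
have -> : a +i* b - z n = (a - complex.Re (z n))%:C + 'i%C * (b - complex.Im (z n))%:C.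
  by rewrite [LHS]complexE; case: (z n).
rewrite (le_lt_trans (ler_normD _ _))// normrM.
rewrite [X in X * _](_ : _ = 1) ?mul1r; last first.
  by rewrite normc_def /= expr0n /= add0r expr1n sqrtr1.
have normC (t : R) : `|t%:C| = `|t|%:C.
  by rewrite normc_def /= expr0n /= addr0 sqrtr_sqr.
rewrite !normC -rmorphD /= ltcR [r]splitr ltrD//.
- by near: n.
- by near: n.
Unshelve. all: by end_near. Qed.
End UltrafilterLimit.

(** * A state invariant under a nondegenerate state is the Haar state *)

Section InvariantState.
Context (R : realType) (G : compactQuantumGroup R).
Context (h phi psi : G -> R[i]).
Hypotheses (h_haar : haar_state h) (phi_state : state phi) (psi_state : state psi).

(** The power of index 0 is [phi] again, so the recursion starts only at index 1. *)
Lemma convolution_powerS (k : nat) : (1 <= k)%N ->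
  convolution_power phi k.+1 = convolution phi (convolution_power phi k).
Proof. by case: k. Qed.

Lemma convolution_power_state k : state (convolution_power phi k).
Proof.
case: k => [//|k]; elim: k => [//|k IH].
by rewrite convolution_powerS//; exact: convolution_state.
Qed.

Lemma convolution_powerSr (k : nat) : (1 <= k)%N ->
  convolution_power phi k.+1 = convolution (convolution_power phi k) phi.
Proof.
case: k => [//|k _]; elim: k => [//|k IH].
have pks := convolution_power_state k.+1.
by rewrite [in RHS]convolution_powerS// convolutionA// -IH.
Qed.

Hypotheses (phi_psi : convolution phi psi = psi) (psi_phi : convolution psi phi = psi).

Lemma power_psi (k : nat) : (1 <= k)%N -> convolution (convolution_power phi k) psi = psi.
Proof.
case: k => [//|k _]; elim: k => [//|k IH].
by rewrite convolution_powerS// convolutionA ?IH//; exact: convolution_power_state.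
Qed.

Lemma psi_power (k : nat) : (1 <= k)%N -> convolution psi (convolution_power phi k) = psi.
Proof.
case: k => [//|k _]; elim: k => [//|k IH].
by rewrite convolution_powerS// -convolutionA ?psi_phi//; exact: convolution_power_state.
Qed.

Lemma invariant_idempotent_state_eq_haar :
  convolution psi psi = psi -> nondegenerate_state phi -> psi = h.
Proof.
move=> psi_psi nd; have [h_state h_inv] := h_haar; apply/funext => a.
have tm := @tens_min R G; pose t := tens G.
pose b : G := slice_right psi (comul G a).
pose X := comul G b - t b 1.
have psi_l := state_scalar psi_state; have psi_n := state_norm psi_state.
have ll := lslice_linear tm psi_l psi_n.
have fixb (k : nat) : (1 <= k)%N -> slice_right (convolution_power phi k) (comul G b) = b.
  move=> k1; have pks := convolution_power_state k.
  by rewrite /b slice_right_comp// power_psi.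
(* If this positive element were nonzero, some [phi^k] would be strictly positive on it; by Fubini
   that value is psi of the right slice of [X^* X] by [phi^k], which is computed to be 0. *)
have c0 : lslice t psi (star X * X) = 0.
  apply/eqP/negPn/negP => /(nd _ (lslice_positive tm psi_state _))[k k1].
  have pks := convolution_power_state k; set pk := convolution_power phi k in pks *.
  have pk_l := state_scalar pks; have pk_n := state_norm pks.
  have rl := rslice_linear tm pk_l pk_n.
  rewrite (slice_Fubini tm psi_state pks).
  have -> : star X * X = comul G (star b * b) - t (star b) 1 * comul G b
      - (comul G (star b) * t b 1 - t (star b) 1 * t b 1).
    have -> : comul G (star b * b) = star (comul G b) * comul G b.
      by rewrite -comul_star -rmorphM.
    rewrite /X starB (tens_star tm) star1 comul_star mulrBl !mulrBr !opprB.
    by rewrite addrACA [RHS]addrACA; congr (_ + _); rewrite addrC.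
  (* By the module property and [fixb], the last three terms of the expansion slice to [star b * b]
     with signs -, -, +. What remains is (psi * phi^k)(b^* b) - psi(b^* b), zero by [psi_power]. *)
  rewrite !(linear_mapB rl) (rsliceMl tm pk_l pk_n) (rsliceMr tm pk_l pk_n).
  rewrite (rsliceMl tm pk_l pk_n) (rslice_tens tm pk_l pk_n).
  rewrite comul_star (rslice_star tm pks).
  rewrite -![rslice t pk (comul G b)]/(slice_right pk (comul G b)) fixb//.
  rewrite (state1 pks) scale1r subrr subr0 (scalarB psi_l).
  have := congr1 (fun f => f (star b * b)) (psi_power k1).
  rewrite convolution_right// => ->.
  by rewrite subrr ltxx.
have F_state := state_tensor tm psi_state h_state.
have FX : h (lslice t psi X) = 0.
  (* Cauchy-Schwarz for the state psi (x) h, whose value at [X^* X] is h of the slice that has just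
     been shown to vanish. *)
  have := state_CauchySchwarz F_state X 1.
  rewrite star1 !mul1r /= c0 (scalar0 (state_scalar h_state)) mul0r => FX.
  by apply/eqP; rewrite -normr_eq0 -sqrf_eq0 eq_le FX exprn_ge0.
move: FX; rewrite (linear_mapB ll) (lslice_tens tm psi_l psi_n).
rewrite (scalarB (state_scalar h_state)) (scalarZ (state_scalar h_state)).
rewrite (state1 h_state) mulr1 => /eqP; rewrite subr_eq0 => /eqP.
rewrite (slice_Fubini tm psi_state h_state).
have -> : rslice t h (comul G b) = h b *: 1 by have [_] := h_inv b.
rewrite (scalarZ psi_l) (state1 psi_state) mulr1.
(* h(b) = (h * psi)(a) = psi(h(a) 1) = h(a), by invariance of h on the other leg. *)
have -> : h b = h a.
  rewrite /b -[LHS]/((fun x => h (slice_right psi (comul G x))) a).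
  rewrite -convolution_right// convolution_left//.
  have [-> _] := h_inv a.
  by rewrite (scalarZ psi_l) (state1 psi_state) mulr1.
move=> ->; rewrite /b -[RHS]/((fun x => psi (slice_right psi (comul G x))) a).
by rewrite -convolution_right// psi_psi.
Qed.

End InvariantState.

(** * Convolution averages and their ultrafilter limits *)

Section Averages.
Context (R : realType) (G : compactQuantumGroup R) (phi : G -> R[i]).
Hypothesis phi_state : state phi.

Local Notation avg := (convolution_average phi).

Let pw_state := convolution_power_state phi_state.

Lemma average_state (n : nat) : (0 < n)%N -> state (avg n).
Proof.
move=> n0; split.
- move=> c x y; rewrite /convolution_average.
  under eq_bigr do rewrite (scalarZD (state_scalar (pw_state _))).
  by rewrite big_split/= -mulr_sumr mulrDr mulrCA.
- move=> _ [y ->]; rewrite mulr_ge0 ?invr_ge0// sumr_ge0// => k _.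
  exact: state_ge0.
rewrite /convolution_average; under eq_bigr do rewrite (state1 (pw_state _)).
by rewrite sumr_const_nat subn1 mulVf// pnatr_eq0 -lt0n.
Qed.

Lemma average_norm n x : `|avg n x| <= `|x|.
Proof.
(* The average of index 0 is the zero functional: not a state, but still contractive. *)
case: n => [|n]; last exact/state_norm/average_state.
by rewrite /convolution_average big_geq// mulr0 normr0.
Qed.

(** The sums telescope to the difference of the last and the first power, of modulus at most
    [2 * |x|], and the division by the number of terms makes this small. [L] stands for the slice by
    [phi] on either side. *)
Lemma average_shift (L : G -> G) x :
    (forall k : nat, (1 <= k)%N ->
       convolution_power phi k (L x) = convolution_power phi k.+1 x) ->
  forall e, 0 < e -> \forall n \near \oo, `|avg n (L x) - avg n x| <= `|x| * e.
Proof.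
move=> Lx e /inv_small[m me]; exists m.+1 => // -[//|n] /= mn.
rewrite /convolution_average -mulrBr.
have -> : \sum_(1 <= k < n.+2) convolution_power phi k (L x) =
    \sum_(1 <= k < n.+2) convolution_power phi k.+1 x.
  by apply: eq_big_nat => k /andP[k1 _]; exact: Lx.
rewrite -sumrB telescope_sumr// normrM ger0_norm ?invr_ge0//.
have nx : `|convolution_power phi n.+2 x - convolution_power phi 1 x| <= `|x| * 2.
  by rewrite (le_trans (ler_normB _ _))// mulr_natr mulr2n lerD// state_norm.
apply: (@le_trans _ _ (n.+1%:R^-1 * (`|x| * 2))).
  by rewrite ler_wpM2l// invr_ge0.
rewrite mulrCA ler_wpM2l// mulrC (le_trans _ (ltW me))//.
by rewrite ler_pM2l// lef_pV2 ?posrE ?ltr0n// ler_nat.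
Qed.

Section UltraLimit.
Context (U : set_system nat) (psi : G -> R[i]).
Hypotheses (U_ultra : UltraFilter U) (oo_U : \oo `<=` U).
Hypothesis psi_lim : forall x, avg n x @[n --> U] --> psi x.

Let psi_near x e : 0 < e -> \forall n \near U, `|psi x - avg n x| < e.
Proof. by move=> e0; have /cvgrPdist_lt/(_ _ e0) := @psi_lim x. Qed.

Let U_pos : \forall n \near U, (0 < n)%N.
Proof. by apply: oo_U; exists 1%N. Qed.

Lemma average_limit_state : state psi.
Proof.
split.
- move=> c x y; apply/eqP; rewrite -subr_eq0; apply/eqP.
  apply: (@norm_eps _ R[i]^o _ (2 + `|c|)) => [|e e0]; first by rewrite addr_ge0.
  have : \forall n \near U, [/\ (0 < n)%N, `|psi (c *: x + y) - avg n (c *: x + y)| < e,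
      `|psi x - avg n x| < e & `|psi y - avg n y| < e].
    near=> n; split; near: n; [exact: U_pos|exact: psi_near..].
  case/filter_ex => n [n0 h1 h2 h3].
  rewrite (_ : psi (c *: x + y) - (c * psi x + psi y) =
      psi (c *: x + y) - avg n (c *: x + y) - (c * (psi x - avg n x)) - (psi y - avg n y)).
    rewrite (le_trans (ler_normB _ _))// mulrDl mulr_natl mulr2n [X in _ <= X]addrAC.
    rewrite lerD ?(ltW h3)// (le_trans (ler_normB _ _))// lerD ?(ltW h1)//.
    by rewrite normrM ler_wpM2l// ltW.
  by rewrite (scalarZD (state_scalar (average_state n0))); ring.
(* In [R[i]] nonnegativity means equality with the modulus, a closed condition that can be checked
   up to a small error. *)
- move=> x x_pos; suff -> : psi x = `|psi x| by [].
  apply/eqP; rewrite -subr_eq0; apply/eqP.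
  apply: (@norm_eps _ R[i]^o _ 2) => // e e0.
  have /filter_ex[n [n0 ne]] : \forall n \near U, (0 < n)%N /\ `|psi x - avg n x| < e.
    by near=> n; split; near: n; [exact: U_pos|exact: psi_near].
  have a0 : 0 <= avg n x by case: (average_state n0) => _ + _; exact.
  rewrite -(subrKA (avg n x)) (le_trans (ler_normD _ _))// mulr_natl mulr2n.
  rewrite lerD ?(ltW ne)// -{1}(ger0_norm a0).
  by rewrite (le_trans (ler_dist_dist _ _))// distrC ltW.
apply/eqP; rewrite -subr_eq0; apply/eqP.
apply: (@norm_eps _ R[i]^o _ 1) => // e e0.
have /filter_ex[n [n0 ne]] : \forall n \near U, (0 < n)%N /\ `|psi 1 - avg n 1| < e.
  by near=> n; split; near: n; [exact: U_pos|exact: psi_near].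
by rewrite mul1r -(state1 (average_state n0)) ltW.
Unshelve. all: by end_near. Qed.

Let limit_shift (L : G -> G) x :
    (forall k : nat, (1 <= k)%N ->
       convolution_power phi k (L x) = convolution_power phi k.+1 x) ->
  psi (L x) = psi x.
Proof.
move=> Lx; apply/eqP; rewrite -subr_eq0; apply/eqP.
apply: (@norm_eps _ R[i]^o _ (2 + `|x|)) => [|e e0]; first by rewrite addr_ge0.
have /filter_ex[n [h1 h2 h3]] : \forall n \near U, [/\ `|psi (L x) - avg n (L x)| < e,
    `|psi x - avg n x| < e & `|avg n (L x) - avg n x| <= `|x| * e].
  near=> n; split; near: n; [exact: psi_near..|].
  by apply: oo_U; exact: average_shift.
rewrite (_ : psi (L x) - psi x = (psi (L x) - avg n (L x)) - (psi x - avg n x)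
   + (avg n (L x) - avg n x)); last by ring.
rewrite mulrDl (le_trans (ler_normD _ _))// lerD// mulr_natl mulr2n.
by rewrite (le_trans (ler_normB _ _))// lerD ?ltW.
Unshelve. all: by end_near. Qed.

Let psi_state := average_limit_state.

Lemma average_limit_left : convolution phi psi = psi.
Proof.
rewrite convolution_left//; apply/funext => x.
apply: (limit_shift (L := fun x => slice_left phi (comul G x))) => k k1.
by rewrite convolution_powerS// convolution_left.
Qed.

(** Slicing on the right appends [phi] as the last convolution factor, hence the appeal to
    [convolution_powerSr], which rests on associativity. *)
Lemma average_limit_right : convolution psi phi = psi.
Proof.
rewrite convolution_right//; apply/funext => x.
apply: (limit_shift (L := fun x => slice_right phi (comul G x))) => k k1.
by rewrite convolution_powerSr// convolution_right.
Qed.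

(** At the left slice [y] of Delta(x) by psi, every power takes the value (psi * phi^k)(x) = psi(x).
    All averages of positive index therefore equal psi(x) at [y], and so does their limit (psi *
    psi)(x). *)
Lemma average_limit_idempotent : convolution psi psi = psi.
Proof.
rewrite convolution_left//; apply/funext => x.
apply/eqP; rewrite -subr_eq0; apply/eqP.
apply: (@norm_eps _ R[i]^o _ 1) => // e e0; set y := slice_left _ _.
have /filter_ex[n [n0 ne]] : \forall n \near U, (0 < n)%N /\ `|psi y - avg n y| < e.
  by near=> n; split; near: n; [exact: U_pos|exact: psi_near].
suff <- : avg n y = psi x by rewrite mul1r ltW.
rewrite /convolution_average (eq_big_nat _ _ (F2 := fun=> psi x)).
  rewrite sumr_const_nat subn1 -[X in _ * X]mulr_natl mulrA mulVf ?mul1r//.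
  by rewrite pnatr_eq0 -lt0n.
move=> k /andP[k1 _].
have := congr1 (fun f => f x) (psi_power phi_state psi_state average_limit_right k1).
by rewrite convolution_left.
Unshelve. all: by end_near. Qed.
End UltraLimit.
End Averages.

Theorem lemma3p3 (R : realType) (G : compactQuantumGroup R)
    (h phi : G -> R[i]) (h_haar : haar_state h) (phi_state : state phi) :
  (nondegenerate_state phi -> weak_star_cvg (convolution_average phi) h) /\
  (faithful_state h ->
     weak_star_cvg (convolution_average phi) h -> nondegenerate_state phi).
Proof.
split=> [nd x|[h_state h_faithful] cv x x_pos x0].
- apply/cvgrPdist_lt => e e0; apply: contrapT => far.
  (* If convergence fails at [x], every tail meets the set [D] of bad indices. An ultrafilter
     containing [D] and all tails has limit h at [x], which contradicts the definition of [D]. *)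
  pose D := [set n | ~ `|h x - convolution_average phi n x| < e].
  have D_proper : ProperFilter (within D \oo).
    split=> [D0|]; last exact: within_filter.
    have {}D0 : \forall n \near \oo, ~ D n by exact: D0.
    by apply: far; near=> n; apply: contrapT; near: n.
  have [U [UU DU]] := ultraFilterLemma D_proper.
  have oo_U : \oo `<=` U.
    by move=> A ooA; apply: DU; apply: filterS ooA => n An _.
  have [psi psi_lim] := choice (fun y =>
    ultra_bounded_complex UU (fun n => average_norm phi_state n y)).
  have psi_state := average_limit_state phi_state UU oo_U psi_lim.
  have psiE : psi = h.
    apply: (invariant_idempotent_state_eq_haar h_haar phi_state psi_state) => //.
    + exact: (average_limit_left phi_state UU oo_U psi_lim).
    + exact: (average_limit_right phi_state UU oo_U psi_lim).
    + exact: (average_limit_idempotent phi_state UU oo_U psi_lim).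
  have near_h : \forall n \near U, `|h x - convolution_average phi n x| < e.
    by rewrite -psiE; have /cvgrPdist_lt/(_ _ e0) := psi_lim x.
  have UD : U D by apply: DU; exact: nearW.
  have /filter_ex[n [far_n near_n]] : U (D `&`
      [set n | `|h x - convolution_average phi n x| < e]).
    exact: filterI.
  exact: far_n.
(* Powers of a state are nonnegative on [x], so if none is positive they all vanish at [x]; then so
   do the averages and their limit h(x), and faithfulness gives [x = 0]. *)
apply: contrapT => vanish.
have pw0 (k : nat) : (1 <= k)%N -> convolution_power phi k x = 0.
  move=> k1; have [_ k_pos _] := convolution_power_state phi_state k.
  apply/eqP/negPn/negP => kx; apply: vanish; exists k => //.
  by rewrite lt0r kx k_pos.
have avg0 n : convolution_average phi n x = 0.
  rewrite /convolution_average big_nat_cond big1 ?mulr0// => k.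
  by rewrite andbT => /andP[k1 _]; exact: pw0.
move/eqP: x0; apply; apply: h_faithful => //.
apply: (@norm_eps _ R[i]^o _ 1) => // e e0.
have /filter_ex[n] : \forall n \near \oo, `|h x - convolution_average phi n x| < e.
  by have /cvgrPdist_lt/(_ _ e0) := cv x.
by rewrite avg0 subr0 mul1r => /ltW.
Unshelve. all: by end_near. Qed.
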